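(* For every integer $t>1$, each of the following circulant graphs is $S_2$ but not Buchsbaum: (i) $C_{8t}(t,4t)$; (ii) $C_{10t}(2t,5t)$ and $C_{10t}(4t,5t)$.
   Context: For an integer $n\geq 1$ and $S\subseteq\{1,2,\ldots,\lfloor n/2\rfloor\}$, the circulant graph $C_n(S)$ has vertex set $\{0,1,\ldots,n-1\}$ and edge set $\{\{i,j\} : |i-j|\in S \text{ or } n-|i-j|\in S\}$. One writes $C_n(a_1,\ldots,a_t)$ for $C_n(\{a_1,\ldots,a_t\})$. The independence complex $\mathrm{Ind}(G)$ of a finite simple graph $G$ is the simplicial complex whose faces are the independent sets of $G$ (including the empty set). A simplicial complex is Buchsbaum if its Stanley-Reisner ring over every field is Buchsbaum; $G$ is Buchsbaum if $\mathrm{Ind}(G)$ is. A simplicial complex $\Delta$ satisfies Serre's condition $S_2$ (over a field $k$) if its Stanley-Reisner ring $R=k[\Delta]$ satisfies $\mathrm{depth}(R_p)\geq\min\{2,\dim R_p\}$ for all primes $p$. It is known that this holds if and only if $\mathrm{link}_\Delta(F)$ is connected for every face $F\in\Delta$ (including $F=\emptyset$) with $\dim\mathrm{link}_\Delta(F)\geq 1$, where $\mathrm{link}_\Delta(F)=\{H\in\Delta : H\cap F=\emptyset,\ H\cup F\in\Delta\}$; in particular it does not depend on $k$. A graph $G$ is called $S_2$ if $\mathrm{Ind}(G)$ satisfies $S_2$. *)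

(* Defs.v *)
From HB Require Import structures.
From mathcomp Require Import all_boot all_order all_algebra.
From mathcomp Require Import boolp.
From mathcomp Require Import mpoly.
From mathcomp Require Import ring.

Set Implicit Arguments.
Unset Strict Implicit.
Unset Printing Implicit Defensive.

Import GRing.Theory.
Local Open Scope ring_scope.
Local Open Scope quotient_scope.

Module Localization.
Section Localization.
Variables (R : comNzRingType) (p : prime_idealr R).

Definition denom := {s : R | s \notin (p : pred R)}.

Lemma denom1_proof : (1 : R) \notin (p : pred R).
Proof. by rewrite idealr1. Qed.

Lemma denomM_proof (s t : denom) : sval s * sval t \notin (p : pred R).
Proof. by rewrite prime_idealrM negb_or (valP s) (valP t). Qed.

Definition denom1 : denom := Sub 1 denom1_proof.
Definition denomM (s t : denom) : denom := Sub (sval s * sval t) (denomM_proof s t).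

(* A pair (a, s) stands for the fraction a / s. *)
Definition frac := (R * denom)%type.

Definition equivl (x y : frac) : bool :=
  `[< exists u : denom, sval u * (x.1 * sval y.2) = sval u * (y.1 * sval x.2) >].

Lemma equivl_refl : reflexive equivl.
Proof. by move=> x; apply/asboolP; exists denom1. Qed.

Lemma equivl_sym : ssrbool.symmetric equivl.
Proof.
by move=> x y; apply/asboolP/asboolP => -[u hu]; exists u; rewrite hu.
Qed.

Lemma equivl_trans : transitive equivl.
Proof.
move=> y x z /asboolP[u hu] /asboolP[v hv]; apply/asboolP.
exists (denomM (denomM u v) y.2); rewrite /=.
transitivity (sval v * sval z.2 * (sval u * (x.1 * sval y.2))); first by ring.
rewrite hu; transitivity (sval u * sval x.2 * (sval v * (y.1 * sval z.2))).
  by ring.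
by rewrite hv; ring.
Qed.

Canonical equivl_equiv := EquivRel equivl equivl_refl equivl_sym equivl_trans.

Definition type := {eq_quot equivl}.
#[export]
HB.instance Definition _ : EqQuotient _ equivl type := EqQuotient.on type.
#[export]
HB.instance Definition _ := Choice.on type.

Lemma eqP_frac (x y : frac) :
  reflect (exists u : denom, sval u * (x.1 * sval y.2) = sval u * (y.1 * sval x.2))
          (x == y %[mod type]).
Proof. by rewrite eqmodE; apply: asboolP. Qed.

Lemma frac_repr (x : frac) : exists u : denom,
  sval u * ((repr (\pi_type x)).1 * sval x.2)
  = sval u * (x.1 * sval (repr (\pi_type x)).2).
Proof. by apply/eqP_frac; rewrite reprK. Qed.

Definition addl (x y : frac) : frac :=
  (x.1 * sval y.2 + y.1 * sval x.2, denomM x.2 y.2).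
Definition oppl (x : frac) : frac := (- x.1, x.2).
Definition mull (x y : frac) : frac := (x.1 * y.1, denomM x.2 y.2).

Definition zero : type := lift_cst type (0, denom1).
Definition one : type := lift_cst type (1, denom1).
Definition add := lift_op2 type addl.
Definition opp := lift_op1 type oppl.
Definition mul := lift_op2 type mull.

Canonical pi_zero_morph := PiConst zero.
Canonical pi_one_morph := PiConst one.

Lemma pi_add : {morph \pi : x y / addl x y >-> add x y}.
Proof.
move=> x y; unlock add; apply/eqP/eqP_frac.
have [u hu] := frac_repr x; have [v hv] := frac_repr y.
move: (repr _) (repr _) hu hv => y' x' hu hv.
exists (denomM u v) => /=.
transitivity (sval v * sval y'.2 * sval y.2 * (sval u * (x.1 * sval x'.2))
              + sval u * sval x'.2 * sval x.2 * (sval v * (y.1 * sval y'.2))).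
  by ring.
by rewrite -hu -hv; ring.
Qed.
Canonical pi_add_morph := PiMorph2 pi_add.

Lemma pi_opp : {morph \pi : x / oppl x >-> opp x}.
Proof.
move=> x; unlock opp; apply/eqP/eqP_frac.
have [u hu] := frac_repr x; exists u.
by rewrite /oppl /= !mulNr !mulrN hu.
Qed.
Canonical pi_opp_morph := PiMorph1 pi_opp.

Lemma pi_mul : {morph \pi : x y / mull x y >-> mul x y}.
Proof.
move=> x y; unlock mul; apply/eqP/eqP_frac.
have [u hu] := frac_repr x; have [v hv] := frac_repr y.
move: (repr _) (repr _) hu hv => y' x' hu hv.
exists (denomM u v) => /=.
transitivity ((sval u * (x.1 * sval x'.2)) * (sval v * (y.1 * sval y'.2))).
  by ring.
by rewrite -hu -hv; ring.
Qed.
Canonical pi_mul_morph := PiMorph2 pi_mul.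

Lemma frac_eq (x y : frac) : x.1 * sval y.2 = y.1 * sval x.2 ->
  x = y %[mod type].
Proof. by move=> h; apply/eqP/eqP_frac; exists denom1; rewrite h. Qed.

Lemma addA : associative add.
Proof.
elim/quotW=> x; elim/quotW=> y; elim/quotW=> z; rewrite !piE.
by apply: frac_eq; rewrite /=; ring.
Qed.

Lemma addC : commutative add.
Proof.
elim/quotW=> x; elim/quotW=> y; rewrite !piE; apply: frac_eq.
by rewrite /= addrC [sval x.2 * _]mulrC.
Qed.

Lemma add0l : left_id zero add.
Proof.
elim/quotW=> x; rewrite !piE; apply: frac_eq.
by rewrite /= mul0r add0r mulr1 mul1r.
Qed.

Lemma addNl : left_inverse zero opp add.
Proof.
elim/quotW=> x; rewrite !piE; apply: frac_eq.
by rewrite /= mulNr addNr !mul0r.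
Qed.

#[export]
HB.instance Definition _ := GRing.isZmodule.Build type addA addC add0l addNl.

Lemma mulA : associative mul.
Proof.
elim/quotW=> x; elim/quotW=> y; elim/quotW=> z; rewrite !piE.
by apply: frac_eq; rewrite /= !mulrA.
Qed.

Lemma mulC : commutative mul.
Proof.
elim/quotW=> x; elim/quotW=> y; rewrite !piE; apply: frac_eq.
by rewrite /= [x.1 * _]mulrC [sval x.2 * _]mulrC.
Qed.

Lemma mul1l : left_id one mul.
Proof.
elim/quotW=> x; rewrite !piE; apply: frac_eq.
by rewrite /= !mul1r.
Qed.

Lemma mulDl : left_distributive mul add.
Proof.
elim/quotW=> x; elim/quotW=> y; elim/quotW=> z; rewrite !piE.
by apply: frac_eq; rewrite /=; ring.
Qed.

Lemma one_neq0 : one != 0 :> type.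
Proof.
rewrite piE; apply/asboolP => -[u] /=.
rewrite mul0r mulr0 !mulr1 => u0.
by case: u u0 => u /= + u0; rewrite u0 idealr0.
Qed.

#[export]
HB.instance Definition _ :=
  GRing.Zmodule_isComNzRing.Build type mulA mulC mul1l mulDl one_neq0.

End Localization.
Module Exports. HB.reexport. End Exports.
End Localization.
Export Localization.Exports.

Definition localization (R : comNzRingType) (p : prime_idealr R) : comNzRingType :=
  Localization.type p.

Section LocalAlgebra.
Variable A : comNzRingType.
Implicit Types (a b y : A) (xs : seq A).

Definition ideal_gen xs a : Prop :=
  exists c : 'I_(size xs) -> A, a = \sum_(i < size xs) c i * xs`_i.

(* dim A >= d: the dimension is the supremum of the lengths d of the strict   *)
(* chains P_0 < P_1 < ... < P_d of prime ideals.                              *)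
Definition krull_dim_ge (d : nat) : Prop :=
  exists P : 'I_d.+1 -> prime_idealr A, forall i j : 'I_d.+1, (i < j)%N ->
    {subset (P i : pred A) <= (P j : pred A)} /\
    ~ {subset (P j : pred A) <= (P i : pred A)}.

Definition krull_dim_eq (d : nat) : Prop :=
  krull_dim_ge d /\ ~ krull_dim_ge d.+1.

(* The next notions are meant for a local ring A, whose maximal ideal is the  *)
(* set of its nonunits.                                                       *)
Definition in_maximal a : Prop := ~ exists b, a * b = 1.

(* The requirement A / (xs) <> 0 on a regular sequence is implied by xs being *)
(* in the maximal ideal, as it is in depth_ge.                                *)
Definition regular_seq xs : Prop :=
  forall (i : nat) a, (i < size xs)%N ->
    ideal_gen (take i xs) (xs`_i * a) -> ideal_gen (take i xs) a.

Definition depth_ge (d : nat) : Prop :=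
  exists xs, [/\ size xs = d, forall x, x \in xs -> in_maximal x
               & regular_seq xs].

(* dim A elements of the maximal ideal that generate an ideal whose radical   *)
(* is the maximal ideal.                                                      *)
Definition system_of_parameters xs : Prop :=
  [/\ krull_dim_eq (size xs), forall x, x \in xs -> in_maximal x
    & forall y, in_maximal y -> exists e : nat, ideal_gen xs (y ^+ e)].

(* ((x_1 .. x_i) : x_(i+1)) is contained in ((x_1 .. x_i) : m), with m the    *)
(* maximal ideal.                                                             *)
Definition weak_seq xs : Prop :=
  forall (i : nat) a y, (i < size xs)%N ->
    ideal_gen (take i xs) (xs`_i * a) -> in_maximal y ->
    ideal_gen (take i xs) (y * a).

Definition buchsbaum_local : Prop :=
  forall xs, system_of_parameters xs -> weak_seq xs.

End LocalAlgebra.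

(* depth (R_p) >= min (r, dim (R_p)) for all primes p: every natural number   *)
(* below both r and dim (R_p) is below depth (R_p).                           *)
Definition serre (r : nat) (R : comNzRingType) : Prop :=
  forall (p : prime_idealr R) (d : nat), (d <= r)%N ->
    krull_dim_ge (localization p) d -> depth_ge (localization p) d.

Record simplicial_complex (n : nat) := SimplicialComplex {
  faces :> {set {set 'I_n}};
  face0 : set0 \in faces;
  face_sub : forall F G : {set 'I_n}, F \subset G -> G \in faces -> F \in faces
}.

Section StanleyReisner.
Variables (k : fieldType) (n : nat) (D : simplicial_complex n).
Local Notation S := {mpoly k[n]}.

Definition sr_ideal : {pred S} := fun f =>
  `[< exists c : {set 'I_n} -> S,
        f = \sum_(F : {set 'I_n} | F \notin (D : {set {set 'I_n}}))
              c F * \prod_(i in F) 'X_i >].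

Definition eval0 (f : S) : k := f.@[fun _ => 0].

Lemma sr_ideal_eval0 f : f \in sr_ideal -> eval0 f = 0.
Proof.
move=> /asboolP[c ->]; rewrite /eval0 rmorph_sum big1 //= => F FD.
have [i iF] : exists i, i \in F.
  by apply/set0Pn; apply: contraNneq FD => ->; exact: face0.
by rewrite rmorphM rmorph_prod /= (bigD1 i) //= mevalXU mul0r mulr0.
Qed.

Lemma sr_ideal_closed : idealr_closed sr_ideal.
Proof.
split.
- apply/asboolP; exists (fun _ => 0).
  by rewrite big1 // => F _; rewrite mul0r.
- apply/negP => /sr_ideal_eval0; rewrite /eval0 rmorph1.
  by move/eqP; rewrite oner_eq0.
- move=> a f g /asboolP[c ->] /asboolP[d ->]; apply/asboolP.
  exists (fun F => a * c F + d F).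
  rewrite mulr_sumr -big_split; apply: eq_bigr => F _.
  by rewrite mulrDl mulrA.
Qed.

HB.instance Definition _ := isIdealr.Build S sr_ideal sr_ideal_closed.

Definition sr_ring : comNzRingType := {ideal_quot sr_ideal}.

Definition sr_proj (f : S) : sr_ring := \pi_{ideal_quot sr_ideal} f.

(* The homogeneous maximal ideal, generated by the classes of the variables.  *)
Definition irrelevant : {pred sr_ring} := fun a =>
  `[< ideal_gen [seq sr_proj 'X_i | i <- enum 'I_n] a >].

Lemma size_vars : size [seq sr_proj 'X_i | i <- enum 'I_n] = n.
Proof. by rewrite size_map size_enum_ord. Qed.

Lemma nth_vars (j : 'I_(size [seq sr_proj 'X_i | i <- enum 'I_n])) :
  [seq sr_proj 'X_i | i <- enum 'I_n]`_j = sr_proj 'X_(cast_ord size_vars j).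
Proof.
have jn : (j < n)%N := ltn_ord (cast_ord size_vars j).
rewrite (nth_map (cast_ord size_vars j)) ?size_enum_ord //.
by congr (sr_proj 'X_ _); apply: val_inj; rewrite /= nth_enum_ord.
Qed.

Lemma eval0_split (f : S) :
  exists g : 'I_n -> S, f = (eval0 f)%:MP + \sum_i g i * 'X_i.
Proof.
pose Q (f : S) := exists c, exists g : 'I_n -> S, f = c%:MP + \sum_i g i * 'X_i.
suff [c [g fE]] : Q f.
  exists g; rewrite {1}fE; congr (_%:MP + _).
  rewrite fE /eval0 rmorphD /= mevalC rmorph_sum big1 ?addr0 // => i _.
  by rewrite rmorphM /= mevalXU mulr0.
have QC c : Q c%:MP.
  by exists c, (fun _ => 0); rewrite big1 ?addr0 // => i _; rewrite mul0r.
have QD (a b : S) : Q a -> Q b -> Q (a + b).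
  move=> [c [g ->]] [d [h ->]]; exists (c + d), (fun i => g i + h i).
  rewrite mpolyCD addrACA -big_split /=; congr (_ + _).
  by apply: eq_bigr => i _; rewrite mulrDl.
have QM (a b : S) : Q a -> Q b -> Q (a * b).
  move=> [c [g ->]] [d [h ->]].
  exists (c * d), (fun i => c%:MP * h i + g i * (d%:MP + \sum_i h i * 'X_i)).
  rewrite mulrDl mulrDr -addrA mpolyCM; congr (_ + _).
  rewrite mulr_sumr mulr_suml -big_split /=.
  by apply: eq_bigr => i _; ring.
have QX i : Q 'X_i.
  exists 0, (fun j => (j == i)%:R); rewrite mpolyC0 add0r (bigD1 i) //= eqxx.
  by rewrite mul1r big1 ?addr0 // => j /negPf ->; rewrite mul0r.
rewrite [f]mpolyE; apply: (big_ind Q) => [||m _].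
- by rewrite -[0]mpolyC0; exact: QC.
- exact: QD.
rewrite -mul_mpolyC; apply: (QM) => //; rewrite mpolyXE_id.
apply: (big_ind Q) => [||i _]; [exact: (QC 1) | exact: QM |].
by elim: (m i) => [|e IH]; rewrite ?exprS; [exact: (QC 1) | exact: QM].
Qed.

Lemma irrelevantE (f : S) : (sr_proj f \in irrelevant) = (eval0 f == 0).
Proof.
apply/asboolP/eqP => [[c fE]|f0].
  have {}fE : sr_proj f = sr_proj (\sum_j repr (c j) * 'X_(cast_ord size_vars j)).
    rewrite fE /sr_proj rmorph_sum; apply: eq_bigr => j _.
    by rewrite nth_vars rmorphM /= reprK.
  move/eqP: fE; rewrite /sr_proj -Quotient.idealrBE => /sr_ideal_eval0.
  rewrite /eval0 rmorphB rmorph_sum /= big1 ?subr0 // => j _.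
  by rewrite rmorphM /= mevalXU mulr0.
have [g ->] := eval0_split f; rewrite f0 mpolyC0 add0r.
exists (fun j => sr_proj (g (cast_ord size_vars j))).
rewrite /sr_proj rmorph_sum (reindex (cast_ord size_vars)) /=; last first.
  by exists (cast_ord (esym size_vars)) => i _; rewrite ?cast_ordK ?cast_ordKV.
by apply: eq_bigr => j _; rewrite nth_vars rmorphM.
Qed.

Lemma irrelevant_closed : idealr_closed irrelevant.
Proof.
split.
- by rewrite -[0](rmorph0 \pi_{ideal_quot sr_ideal}) irrelevantE /eval0 rmorph0.
- rewrite -[1](rmorph1 \pi_{ideal_quot sr_ideal}) irrelevantE /eval0 rmorph1.
  exact: oner_neq0.
- elim/quotW=> a; elim/quotW=> f; elim/quotW=> g.
  rewrite !irrelevantE => /eqP f0 /eqP g0.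
  rewrite -rmorphM -rmorphD irrelevantE /eval0 rmorphD rmorphM /=.
  by rewrite -!/(eval0 _) f0 g0 mulr0 addr0.
Qed.

Lemma irrelevant_prime : prime_idealr_closed irrelevant.
Proof.
elim/quotW=> f; elim/quotW=> g; rewrite -rmorphM !irrelevantE /eval0 rmorphM /=.
by rewrite mulf_eq0.
Qed.

HB.instance Definition _ := isIdealr.Build sr_ring irrelevant irrelevant_closed.
HB.instance Definition _ :=
  isPrimeIdealrClosed.Build sr_ring irrelevant irrelevant_prime.

End StanleyReisner.

Definition S2_complex (n : nat) (D : simplicial_complex n) : Prop :=
  forall k : fieldType, serre 2 (sr_ring k D).

(* A standard graded k-algebra is Buchsbaum when its localization at the      *)
(* homogeneous maximal ideal is.                                              *)
Definition buchsbaum_complex (n : nat) (D : simplicial_complex n) : Prop :=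
  forall k : fieldType, buchsbaum_local (localization (@irrelevant k n D)).

Record sgraph (n : nat) := SGraph {
  adj :> rel 'I_n;
  adj_sym : ssrbool.symmetric adj;
  adj_irr : irreflexive adj
}.

Section Independence.
Variables (n : nat) (G : sgraph n).

Definition independent (A : {set 'I_n}) : bool :=
  [forall x in A, forall y in A, ~~ adj G x y].

Lemma independent0 : set0 \in [set A | independent A].
Proof. by rewrite inE; apply/forall_inP => x; rewrite inE. Qed.

Lemma independent_sub (A B : {set 'I_n}) : A \subset B ->
  B \in [set A | independent A] -> A \in [set A | independent A].
Proof.
move=> /subsetP AB; rewrite !inE => /forall_inP indB.
apply/forall_inP => x /AB /indB /forall_inP indx.
by apply/forall_inP => y /AB /indx.
Qed.

Definition Ind : simplicial_complex n :=
  SimplicialComplex independent0 independent_sub.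

End Independence.

Definition S2_graph (n : nat) (G : sgraph n) : Prop := S2_complex (Ind G).

Definition buchsbaum_graph (n : nat) (G : sgraph n) : Prop :=
  buchsbaum_complex (Ind G).

Section Circulant.
Variables (n : nat) (s : seq nat).

(* The set s of jumps is meant to be contained in {1, .., n./2}; the guard    *)
(* i != j is then automatic.                                                  *)
Definition circulant_adj : rel 'I_n := fun i j =>
  (i != j) && ((`|i - j|%N \in s) || ((n - `|i - j|)%N \in s)).

Lemma circulant_sym : ssrbool.symmetric circulant_adj.
Proof. by move=> i j; rewrite /circulant_adj eq_sym distnC. Qed.

Lemma circulant_irr : irreflexive circulant_adj.
Proof. by move=> i; rewrite /circulant_adj eqxx. Qed.

Definition circulant : sgraph n := SGraph circulant_sym circulant_irr.

End Circulant.

(* Main.v *)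
(* Each of the graphs is a disjoint union of t copies of a circulant graph on N
   vertices whose maximal independent sets form a cyclic band: they are T_0, ..,
   T_(N-1), with T_q and T_(q+1) sharing all but one vertex.  So the independence
   complex D of the whole graph is a t-fold join of annuli (or solid tori).

   S_2.  A set of variables outside of a prime p is a face G, and k[D]_p embeds
   in the product of the localized polynomial rings k[F] over the facets F
   containing G.  If two elements x, y of p are coprime on every such F and x does
   not vanish on the ridges through G, then y b in (x) makes x divide b on each
   facet, and the quotients agree on ridges; as the facets around any face are
   connected through ridges, they glue, so x, y is a regular sequence.  Elementary
   symmetric polynomials in the variables outside of G serve as x and y, except
   when G is a ridge or a facet; there one uses that a prime of a polynomial ring
   is zero, or has a discrete valuation ring as its localization, or contains a
   regular sequence of length two locally.

   Not Buchsbaum.  The elementary symmetric polynomials e_1, e_2, .. of the copies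
   form a system of parameters.  Let c be the cocycle of the first band that is 1
   on the seam between T_(N-1) and T_0, and write e_i c = d w_i.  Then
   a = e_1 w_2 - e_2 w_1 is a cocycle, hence an element of k[D], and e_3 a is in
   (e_1, e_2).  If y a were in (e_1, e_2) for a vertex y of another copy, then
   coprimality of e_1 and e_2 on each T_q would make y c a coboundary, which the
   coefficients of y on the T_q forbid. *)

Require Import Defs.
From HB Require Import structures.
From mathcomp Require Import all_boot all_order all_algebra.
From mathcomp Require Import boolp.
From mathcomp Require Import mpoly.
From mathcomp Require Import ring zify.

Set Implicit Arguments.
Unset Strict Implicit.
Unset Printing Implicit Defensive.

Import GRing.Theory.
Local Open Scope ring_scope.
Local Open Scope quotient_scope.

(** * Primes of polynomial rings *)

(** Primes are plain [Prop] predicates, so that preimages under ring morphisms and kernels of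
    restrictions need no bundled ideal. *)
Record prime_pred (A : comNzRingType) (P : A -> Prop) : Prop := PrimePred {
  prime_pred0 : P 0;
  prime_pred1 : ~ P 1;
  prime_predD : forall a b, P a -> P b -> P (a + b);
  prime_predMl : forall a b, P b -> P (a * b);
  prime_predM : forall a b, P (a * b) -> P a \/ P b }.

Section PrimePred.
Variables (A : comNzRingType) (P : A -> Prop).
Hypothesis prP : prime_pred P.

Lemma prime_predMr a b : P a -> P (a * b).
Proof. by rewrite mulrC; apply: (prime_predMl prP). Qed.

Lemma prime_predN a : P a -> P (- a).
Proof. by rewrite -mulN1r; apply: (prime_predMl prP). Qed.

Lemma prime_predB a b : P a -> P b -> P (a - b).
Proof. by move=> Pa Pb; apply: (prime_predD prP) => //; apply: prime_predN. Qed.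

Lemma prime_pred_sum (I : Type) (r : seq I) (Q : pred I) (F : I -> A) :
  (forall i, Q i -> P (F i)) -> P (\sum_(i <- r | Q i) F i).
Proof.
by move=> PF; apply: big_ind => //; [exact: (prime_pred0 prP)|exact: (prime_predD prP)].
Qed.

Lemma prime_predNM a b : ~ P a -> ~ P b -> ~ P (a * b).
Proof. by move=> Na Nb /(prime_predM prP)[]. Qed.

Lemma prime_predNX a n : ~ P a -> ~ P (a ^+ n).
Proof.
move=> Na; elim: n => [|n IH]; first by rewrite expr0; exact: (prime_pred1 prP).
by rewrite exprS; apply: prime_predNM.
Qed.

Lemma prime_predX a n : P (a ^+ n) -> P a.
Proof. by move=> Pan; apply: contrapT => /prime_predNX/(_ Pan). Qed.

Lemma prime_pred_addl a b : P (a + b) -> P a -> P b.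
Proof. by move=> /prime_predB H /H; rewrite addrAC subrr add0r. Qed.

Lemma prime_pred_prod (I : finType) (Q : pred I) (F : I -> A) :
  P (\prod_(i | Q i) F i) -> exists2 i, Q i & P (F i).
Proof.
move=> PF; apply: contrapT => /forall2NP N; move: PF.
apply: (big_ind (fun x => ~ P x)); first exact: (prime_pred1 prP).
  exact: prime_predNM.
by move=> i Qi; case: (N i).
Qed.

End PrimePred.

Lemma prime_pred_preim (A B : comNzRingType) (f : {rmorphism A -> B})
    (P : B -> Prop) : prime_pred P -> prime_pred (P \o f).
Proof.
move=> prP; split=> /= [|||a b|a b].
- by rewrite rmorph0; exact: (prime_pred0 prP).
- by rewrite rmorph1; exact: (prime_pred1 prP).
- by move=> a b; rewrite rmorphD; exact: (prime_predD prP).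
- by rewrite rmorphM; exact: (prime_predMl prP).
- by rewrite rmorphM; exact: (prime_predM prP).
Qed.

(* The localization at P is a discrete valuation ring with uniformizer g. *)
Definition dvr_at (A : comNzRingType) (P : A -> Prop) : Prop :=
  exists2 g, P g & forall a, a <> 0 ->
    exists (n : nat) u b, [/\ ~ P u, ~ P b & u * a = g ^+ n * b].

(* g2, g1 is a regular sequence in the localization at P. *)
Definition regular_pair_at (A : comNzRingType) (P : A -> Prop) : Prop :=
  exists g1 g2, [/\ P g1, P g2, g2 <> 0
    & forall a b, g1 * a = g2 * b -> exists w c, ~ P w /\ w * a = g2 * c].

(** For polynomial rings over a field the cases reflect height 0, height 1 and height at least 2;
    the elementwise form avoids dimension theory. *)
Definition prime_trichotomy (A : comNzRingType) : Prop :=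
  forall P : A -> Prop, prime_pred P ->
    [\/ forall a, P a -> a = 0, dvr_at P | regular_pair_at P].

(** A nonzero element of [Q] is a power of the uniformizer up to factors outside [P], so [Q]
    contains the uniformizer, which divides every element of [P] locally. *)
Lemma dvr_at_no_between (A : comNzRingType) (P Q : A -> Prop) :
  prime_pred P -> prime_pred Q -> dvr_at P -> (forall a, Q a -> P a) ->
  (exists2 a, Q a & a <> 0) -> forall a, P a -> Q a.
Proof.
move=> prP prQ [g Pg gP] QP [f Qf f0] a Pa.
have Qg : Q g.
  have [n [u [b [Nu Nb E]]]] := gP f f0.
  have /(prime_predM prQ)[Qgn|/QP//] : Q (g ^+ n * b).
    by rewrite -E; exact: (prime_predMl prQ).
  exact: (prime_predX prQ Qgn).
have [->|/gP[n [u [b [Nu Nb E]]]]] := EM (a = 0); first exact: (prime_pred0 prQ).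
case: n E => [|n] E.
  case: (prime_predNM prP Nu Nb); move: (prime_predMl prP u Pa).
  by rewrite E expr0 mul1r => /Nb.
have /(prime_predM prQ)[/QP//|//] : Q (u * a).
by rewrite E exprS -mulrA; exact: prime_predMr.
Qed.

Lemma prime_trichotomy_can (A B : comNzRingType) (f : {rmorphism A -> B})
    (g : {rmorphism B -> A}) :
  cancel f g -> cancel g f -> prime_trichotomy B -> prime_trichotomy A.
Proof.
move=> fK gK tB P prP; case: (tB _ (prime_pred_preim g prP)) => /=.
- move=> P0; constructor 1 => a Pa; have := P0 (f a); rewrite /= fK => /(_ Pa) fa0.
  by rewrite -[a]fK fa0 rmorph0.
- move=> [h Ph hP]; constructor 2; exists (g h) => // a a0.
  have [|n [u [b [Nu Nb E]]]] := hP (f a).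
    by move=> fa0; apply: a0; rewrite -[a]fK fa0 rmorph0.
  exists n, (g u), (g b); split=> //.
  by rewrite -{1}[a]fK -rmorphM E rmorphM rmorphXn.
- move=> [h1 [h2 [P1 P2 h20 reg]]]; constructor 3; exists (g h1), (g h2); split=> //.
    by move=> E; apply: h20; rewrite -[h2]gK E rmorph0.
  move=> a b E; have [|w [c [Nw E']]] := reg (f a) (f b).
    by rewrite -{1}[h1]gK -rmorphM E rmorphM gK.
  by exists (g w), (g c); split=> //; rewrite -{1}[a]fK -!rmorphM E'.
Qed.

Lemma prime_trichotomy_field (k : fieldType) : prime_trichotomy k.
Proof.
move=> P prP; constructor 1 => a Pa; apply/eqP; apply: contrapT => /negP a0.
case: (prime_pred1 prP); rewrite -(mulVf a0); exact: (prime_predMl prP).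
Qed.

(* Gauss: the lowest coefficients outside of q multiply to one outside of q. *)
Lemma coefs_not_prime (B : comNzRingType) (q : B -> Prop) (f h : {poly B}) :
  prime_pred q -> (forall i, q (f * h)`_i) -> (exists i, ~ q f`_i) ->
  forall i, q h`_i.
Proof.
move=> prq qfh [i0 Ni0].
have [i Ni mi] : exists2 i, ~ q f`_i & forall j, (j < i)%N -> q f`_j.
  have ex : exists i, `[< ~ q f`_i >] by exists i0; apply/asboolP.
  exists (ex_minn ex); case: ex_minnP => i /asboolP // Ni mi j ji.
  by apply: contrapT => /asboolP/mi; rewrite leqNgt ji.
move=> j; elim/ltn_ind: j => j IH.
have := qfh (i + j)%N; rewrite coefM (bigD1 (inord i)) //= inordK ?ltnS ?leq_addr //.
rewrite addKn addrC => /(prime_pred_addl prq) H.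
have /(prime_predM prq)[//|//] : q (f`_i * h`_j).
apply: H; apply: (prime_pred_sum prq) => l.
rewrite -val_eqE /= inordK ?ltnS ?leq_addr // neq_ltn => /orP[li|il].
  by apply: (prime_predMr prq); apply: mi.
apply: (prime_predMl prq); apply: IH; rewrite ltn_subLR ?ltn_add2r //.
by rewrite -ltnS.
Qed.

(** * Primes of B[X] over a prime of B *)

Section TrichotomyPoly.
Variables (B : idomainType).
Variables (P : {poly B} -> Prop) (q : B -> Prop).
Hypotheses (prP : prime_pred P) (prq : prime_pred q).
Hypothesis Pq : forall b, P b%:P <-> q b.

Lemma common_denominator (h : B) (a : {poly B}) :
  (forall i, exists w c, ~ q w /\ w * a`_i = h * c) ->
  exists w (c : {poly B}), ~ q w /\ w%:P * a = h%:P * c.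
Proof.
elim/poly_ind: a => [|a x IH] wP.
  by exists 1, 0; rewrite !mulr0; split=> //; exact: (prime_pred1 prq).
have [i|w [c [Nw E]]] := IH.
  have [w [c E]] := wP i.+1; exists w, c.
  by move: E; rewrite coefD coefMX coefC addr0.
have [v [d [Nv]]] := wP 0%N; rewrite coefD coefMX coefC add0r => Ev.
exists (w * v), (v%:P * c * 'X + (w * d)%:P); split; first exact: (prime_predNM prq).
transitivity (v%:P * (w%:P * a) * 'X + w%:P * (v * x)%:P); first by rewrite !polyCM; ring.
by rewrite E Ev !polyCM; ring.
Qed.

(** B[X] is free over B, so regularity of a pair of constants is tested coefficient by
    coefficient. *)
Lemma regular_pair_at_poly : regular_pair_at q -> regular_pair_at P.
Proof.
move=> [g1 [g2 [q1 q2 g20 reg]]]; exists g1%:P, g2%:P; split; try exact/Pq.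
  by move/eqP; rewrite polyC_eq0 => /eqP.
move=> a b E; have [i|w [c [Nw Ew]]] := @common_denominator g2 a.
  apply: (reg _ b`_i).
  by move/(congr1 (fun f : {poly B} => f`_i)): E; rewrite !coefCM.
by exists w%:P, c; split=> // /Pq.
Qed.

(** The case of [P] extended from [q]. The uniformizer of [q] still works, the valuation being the
    least one among the coefficients (Gauss valuation). *)
Lemma dvr_at_poly : dvr_at q -> (forall f, P f -> forall i, q f`_i) -> dvr_at P.
Proof.
move=> [g qg gq] Pcoef; exists g%:P; first exact/Pq.
move=> a a0.
pose V n i := exists u c, [/\ a`_i <> 0, ~ q u, ~ q c & u * a`_i = g ^+ n * c].
have ex : exists n, `[< exists i, V n i >].
  have [i /eqP ai0] : exists i, a`_i != 0.
    by exists (size a).-1; rewrite -lead_coefE lead_coef_eq0; apply/eqP.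
  have [n [u [c [Nu Nc E]]]] := gq _ ai0.
  by exists n; apply/asboolP; exists i, u, c.
case: (ex_minnP ex) => n /asboolP [i [u [c [ai0 Nu Nc E]]]] nmin.
have [j|w [b [Nw Ew]]] := @common_denominator (g ^+ n) a.
  have [->|aj0] := EM (a`_j = 0).
    by exists 1, 0; rewrite !mulr0; split=> //; exact: (prime_pred1 prq).
  have [m [v [d [Nv Nd Ed]]]] := gq _ aj0.
  have nm : (n <= m)%N by apply: nmin; apply/asboolP; exists j, v, d.
  by exists v, (g ^+ (m - n) * d); rewrite mulrA -exprD subnKC.
exists n, w%:P, b; split; first by move/Pq.
  move/Pcoef/(_ i) => qb; have : q (w * c); last exact: (prime_predNM prq).
  suff -> : w * c = u * b`_i by exact: (prime_predMl prq).
  have gn0 : g ^+ n != 0.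
    apply/eqP => gn0; move/eqP: E; rewrite gn0 mul0r mulf_eq0 => /orP[/eqP u0|/eqP//].
    by apply: Nu; rewrite u0; exact: (prime_pred0 prq).
  apply: (mulfI gn0).
  have := congr1 (fun f : {poly B} => f`_i) Ew; rewrite !coefCM => E2.
  by rewrite mulrCA -E mulrCA E2; ring.
by rewrite -polyC_exp.
Qed.

(** If [f] has a coefficient outside [q], then [f * a = g * b] forces all coefficients of [a] into
    [q] by Gauss, so the uniformizer [g] divides [a] locally. *)
Lemma regular_pair_at_poly_dvr (f : {poly B}) :
  dvr_at q -> (exists2 r, q r & r <> 0) -> P f -> (exists i, ~ q f`_i) ->
  regular_pair_at P.
Proof.
move=> [g qg gq] [r qr r0] Pf Nf.
have posn a n u b : q a -> ~ q u -> ~ q b -> u * a = g ^+ n * b -> (0 < n)%N.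
  case: n => // qa Nu Nb; rewrite expr0 mul1r => E; case: Nb; rewrite -E.
  exact: (prime_predMl prq).
exists f, g%:P; split=> //; first exact/Pq.
  move=> /eqP; rewrite polyC_eq0 => /eqP g0.
  have [n [u [b [Nu Nb E]]]] := gq _ r0.
  move/eqP: (E); rewrite g0 expr0n gtn_eqF ?(posn _ _ _ _ qr Nu Nb E) // mul0r.
  rewrite mulf_eq0 => /orP[/eqP u0|/eqP//].
  by apply: Nu; rewrite u0; exact: (prime_pred0 prq).
move=> a b E.
have qa : forall i, q a`_i.
  apply: (coefs_not_prime prq _ Nf) => i; rewrite E coefCM.
  exact: (prime_predMr prq).
have [i|w [c [Nw Ew]]] := @common_denominator g a; last first.
  by exists w%:P, c; split=> // /Pq.
have [->|ai0] := EM (a`_i = 0).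
  by exists 1, 0; rewrite !mulr0; split=> //; exact: (prime_pred1 prq).
have [n [u [d [Nu Nd Ed]]]] := gq _ ai0.
case: n Ed (posn _ _ _ _ (qa i) Nu Nd Ed) => // n Ed _.
by exists u, (g ^+ n * d); rewrite mulrA -exprS.
Qed.

(* Over the fraction field of B the ideal P is generated by an element of P of
   minimal degree. *)
Lemma dvr_at_poly0 : (forall b, q b -> b = 0) -> (exists2 f, P f & f <> 0) -> dvr_at P.
Proof.
move=> q0 [f0 Pf0 f0N0].
have PC b : P b%:P -> b = 0 by move/Pq/q0.
have ex : exists n, `[< exists f, [/\ P f, f <> 0 & size f = n] >].
  by exists (size f0); apply/asboolP; exists f0.
case: (ex_minnP ex) => n /asboolP[f [Pf fN0 sf]] nmin.
have fmin h : P h -> (size h < size f)%N -> h = 0.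
  move=> Ph; rewrite sf ltnNge => /negP hn; apply: contrapT => h0.
  by apply: hn; apply: nmin; apply/asboolP; exists h.
have s1 : (1 < size f)%N.
  rewrite ltnNge; apply/negP => /size1_polyC fE; apply: fN0.
  by rewrite fE in Pf *; rewrite (PC _ Pf).
exists f => // a a0; elim: {a} (size a) {-2}a (leqnn (size a)) a0 => [|s IH] a sa a0.
  by case: a0; apply/eqP; rewrite -size_poly_eq0 -leqn0.
have [Pa|Na] := EM (P a); last first.
  by exists 0%N, 1, a; rewrite expr0; split=> //; exact: (prime_pred1 prP).
(* Pseudo-division multiplies by this power of the leading coefficient; it is a nonzero constant,
   hence outside [P]. *)
pose c := lead_coef f ^+ scalp a f.
have cN0 : c != 0 by rewrite expf_neq0 // lead_coef_eq0; apply/eqP.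
have Nc : ~ P c%:P by move/PC/eqP; apply/negP.
have dE : c%:P * a = a %/ f * f + a %% f by rewrite mul_polyC; exact: Pdiv.Idomain.divp_eq.
have m0 : a %% f = 0.
  apply: fmin; last by rewrite Pdiv.Idomain.ltn_modp; apply/eqP.
  apply: (@prime_pred_addl _ _ prP (a %/ f * f)); last exact: (prime_predMl prP).
  by rewrite -dE; exact: (prime_predMl prP).
rewrite m0 addr0 in dE.
have dN0 : a %/ f != 0.
  apply/eqP => d0; move/eqP: dE; rewrite d0 mul0r mulf_eq0 polyC_eq0 (negPf cN0) /=.
  by move/eqP.
have [||m [u [b [Nu Nb E]]]] := IH (a %/ f).
- rewrite -ltnS; apply: leq_trans sa.
  have -> : size a = size (a %/ f * f) by rewrite -dE mul_polyC size_scale.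
  rewrite size_mul //; last by apply/eqP.
  by case: (size f) s1 => [|[|l]] // _; rewrite !addnS /= ltnS leq_addr.
- exact/eqP.
exists m.+1, (u * c%:P), b; split=> //; first exact: (prime_predNM prP).
by rewrite -mulrA dE mulrA E exprS; ring.
Qed.

End TrichotomyPoly.

(** Cases follow the contraction [q] of [P]. Over zero, [P] is zero or has a uniformizer; over a
    uniformizer, [P] is extended from [q] or has a regular pair; a regular pair at [q] passes to
    [P]. *)
Lemma prime_trichotomy_poly (B : idomainType) :
  prime_trichotomy B -> prime_trichotomy {poly B}.
Proof.
move=> tB P prP; pose q b := P b%:P.
have prq : prime_pred q by exact: (@prime_pred_preim B {poly B} (@polyC B) P prP).
have Pq b : P b%:P <-> q b by [].
have [qr|/forall2NP q0] := EM (exists2 r, q r & r <> 0); last first.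
  have {}q0 b : q b -> b = 0 by case: (q0 b) => // /contrapT.
  have [Pf|/forall2NP P0] := EM (exists2 f, P f & f <> 0).
    by constructor 2; exact: (dvr_at_poly0 prP Pq q0).
  by constructor 1 => f Pf; case: (P0 f) => // /contrapT.
case: (tB q prq) => [q0|dq|rq]; last by constructor 3; exact: (regular_pair_at_poly prq Pq rq).
  by case: qr => r /q0.
have [[f Pf Nf]|/forall2NP PN] := EM (exists2 f, P f & exists i, ~ q f`_i).
  by constructor 3; exact: (regular_pair_at_poly_dvr prq Pq dq qr Pf Nf).
constructor 2; apply: (dvr_at_poly prq Pq dq) => f Pf i; apply: contrapT => Nq.
by case: (PN f) => //; apply; exists i.
Qed.

Lemma mpoly_rmorph_ext (n : nat) (k A : comNzRingType)
    (f g : {rmorphism {mpoly k[n]} -> A}) :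
  (forall c, f c%:MP = g c%:MP) -> (forall i, f 'X_i = g 'X_i) -> f =1 g.
Proof.
move=> fgC fgX p; rewrite [p]mpolyE !rmorph_sum; apply: eq_bigr => m _.
rewrite -mul_mpolyC !rmorphM fgC mpolyXE_id !rmorph_prod; congr (_ * _).
by apply: eq_bigr => i _; rewrite !rmorphXn fgX.
Qed.

(** Induction on the number of variables: [muni] singles out the last variable, and its inverse [h]
    evaluates at it. *)
Lemma prime_trichotomy_mpoly (k : fieldType) (n : nat) : prime_trichotomy {mpoly k[n]}.
Proof.
elim: n => [|n IH].
  apply: (@prime_trichotomy_can _ k (@mcoeff 0 k 0%MM) (@mpolyC 0 k)).
  - by move=> p; rewrite [RHS]nvar0_mpolyC.
  - exact: mpolyCK.
  - exact: prime_trichotomy_field.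
pose w : {rmorphism _ -> _} := @mwiden n k.
have [h hC hX] : exists2 h : {rmorphism {poly {mpoly k[n]}} -> {mpoly k[n.+1]}},
    forall p, h p%:P = w p & h 'X = 'X_ord_max.
  have cw : commr_rmorph w ('X_ord_max) by move=> x; exact: mulrC.
  exists (horner_morph cw) => [p|]; first exact: horner_morphC.
  exact: horner_morphX.
have muniX : muni ('X_ord_max : {mpoly k[n.+1]}) = 'X.
  rewrite muniE msuppX big_seq1 mcoeffX eqxx scale1r mnm1E eqxx.
  rewrite (_ : [multinom _ | i < n] = 0%MM) ?mpolyX0 ?scale1r //.
  apply/mnmP => i; rewrite mnmE mnm0E mnm1E -val_eqE /= gtn_eqF //.
have muniXw (i : 'I_n) : muni ('X_(widen_ord (leqnSn n) i) : {mpoly k[n.+1]}) = ('X_i)%:P.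
  rewrite muniE msuppX big_seq1 mcoeffX eqxx scale1r mnm1E -val_eqE /= ltn_eqF //.
  rewrite expr0 alg_polyC; congr ('X_[_])%:P.
  by apply/mnmP => j; rewrite mnmE !mnm1E -!val_eqE.
have wX (i : 'I_n) : w 'X_i = 'X_(widen_ord (leqnSn n) i).
  by rewrite /w /= mwidenX mnmwiden1.
apply: (@prime_trichotomy_can _ {poly {mpoly k[n]}} (@muni n k) h).
- move=> p; apply: (mpoly_rmorph_ext (f := h \o @muni n k) (g := idfun)).
    by move=> c; rewrite /= muniC hC /w /= mwidenC.
  move=> i /=; have [lt|] := ltnP i n.
    have -> : i = widen_ord (leqnSn n) (Ordinal lt) by exact: val_inj.
    by rewrite muniXw hC wX.
  rewrite leq_eqVlt ltnNge -ltnS ltn_ord orbF => /eqP Ei.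
  have -> : i = ord_max by exact: val_inj.
  by rewrite muniX hX.
- move=> p; rewrite -[p]coefK poly_def !rmorph_sum; apply: eq_bigr => i _.
  rewrite -mul_polyC !rmorphM !rmorphXn hC hX /= muniX; congr (_ * _).
  apply: (mpoly_rmorph_ext (f := @muni n k \o w) (g := @polyC _)).
    by move=> c; rewrite /= mwidenC muniC.
  by move=> j; rewrite /= wX muniXw.
exact: prime_trichotomy_poly.
Qed.

(** * Restriction to faces and elementary symmetric polynomials *)

Section Substitution.
Variables (k : comNzRingType) (n m : nat).
Implicit Types (h : 'I_n -> {mpoly k[m]}) (p : {mpoly k[n]}).

Definition msubst h p : {mpoly k[m]} := mmap (@mpolyC m k) h p.

HB.instance Definition _ h := GRing.RMorphism.copy (msubst h) (msubst h).

Lemma msubstC h c : msubst h c%:MP = c%:MP.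
Proof. exact: mmapC. Qed.

Lemma msubstX h i : msubst h 'X_i = h i.
Proof. by rewrite /msubst mmapX mmap1U. Qed.

Lemma msubstXm h (u : 'X_{1..n}) : msubst h 'X_[u] = \prod_i h i ^+ u i.
Proof. by rewrite /msubst mmapX. Qed.

Lemma msubstZ h c p : msubst h (c *: p) = c *: msubst h p.
Proof. by rewrite -!mul_mpolyC rmorphM /= msubstC. Qed.

Lemma msubst_congr (J : {mpoly k[m]} -> Prop) h h' p :
  J 0 -> (forall a b, J a -> J b -> J (a + b)) -> (forall a b, J b -> J (a * b)) ->
  (forall i, J (h i - h' i)) -> J (msubst h p - msubst h' p).
Proof.
move=> J0 JD JM Jh; rewrite [p]mpolyE !rmorph_sum /= -sumrB.
apply: (big_ind J) => // u _; rewrite !msubstZ -scalerBr -mul_mpolyC; apply: (JM).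
have JMM a a' b b' : J (a - a') -> J (b - b') -> J (a * b - a' * b').
  move=> Ja Jb; have -> : a * b - a' * b' = b * (a - a') + a' * (b - b') by ring.
  by apply: JD; apply: (JM).
rewrite !msubstXm; apply: (big_ind2 (fun x y => J (x - y))) => [||i _].
- by rewrite subrr.
- by move=> a a' b b'; exact: JMM.
by elim: (u i) => [|e IH]; rewrite ?subrr // !exprS; exact: JMM.
Qed.

End Substitution.

Lemma msubst_comp (k : comNzRingType) (n m l : nat) (h : 'I_n -> {mpoly k[m]})
    (g : 'I_m -> {mpoly k[l]}) p :
  msubst g (msubst h p) = msubst (msubst g \o h) p.
Proof.
apply: (mpoly_rmorph_ext (f := msubst g \o msubst h) (g := msubst (msubst g \o h))).
  by move=> c; rewrite /= !msubstC.
by move=> i; rewrite /= !msubstX.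
Qed.

Lemma msubst_id (k : comNzRingType) (n : nat) (h : 'I_n -> {mpoly k[n]}) p :
  (forall i, h i = 'X_i) -> msubst h p = p.
Proof.
move=> hX; apply: (mpoly_rmorph_ext (f := msubst h) (g := idfun)).
  by move=> c; rewrite /= msubstC.
by move=> i; rewrite /= msubstX.
Qed.

Section Restriction.
Variables (k : idomainType) (n : nat).
Local Notation S := {mpoly k[n]}.
Implicit Types (A F G : {set 'I_n}) (p q : S) (u : 'X_{1..n}).

(** The projection onto the polynomial ring on the variables of [F], kept as an endomorphism so that
    the rings of all faces live in one ambient ring. *)
Definition restr F : S -> S := msubst (fun i => if i \in F then 'X_i else 0).

HB.instance Definition _ F := GRing.RMorphism.copy (restr F) (restr F).

Lemma restrM F p q : restr F (p * q) = restr F p * restr F q.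
Proof. exact: rmorphM. Qed.

Lemma restrD F p q : restr F (p + q) = restr F p + restr F q.
Proof. exact: rmorphD. Qed.

Lemma restrB F p q : restr F (p - q) = restr F p - restr F q.
Proof. exact: rmorphB. Qed.

Lemma restr0 F : restr F 0 = 0.
Proof. exact: rmorph0. Qed.

Definition msup u : {set 'I_n} := [set i | u i != 0%N].

Definition filt (P : pred {set 'I_n}) p : S :=
  \sum_(u <- msupp p | P (msup u)) p@_u *: 'X_[u].

Lemma mcoeff_filt P p u : (filt P p)@_u = if P (msup u) then p@_u else 0.
Proof.
rewrite /filt raddf_sum /= [in RHS](mpolyE p) raddf_sum /=.
case: ifP => Pu.
  rewrite [LHS]big_mkcond; apply: eq_bigr => v _; case: ifP => // Pv.
  rewrite mcoeffZ mcoeffX; case: eqP => [vu|]; last by rewrite mulr0.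
  by rewrite vu Pu in Pv.
rewrite big1 // => v Pv; rewrite mcoeffZ mcoeffX; case: eqP => [vu|]; last by rewrite mulr0.
by rewrite vu Pu in Pv.
Qed.

Lemma restrX F i : restr F 'X_i = if i \in F then 'X_i else 0.
Proof. exact: msubstX. Qed.

Lemma restrC F c : restr F c%:MP = c%:MP.
Proof. exact: msubstC. Qed.

Lemma restrZ F c p : restr F (c *: p) = c *: restr F p.
Proof. exact: msubstZ. Qed.

Lemma restrXm F u : restr F 'X_[u] = if msup u \subset F then 'X_[u] else 0.
Proof.
rewrite [LHS]msubstXm; case: ifP => [/subsetP uF|/subsetPn[i]].
  rewrite mpolyXE_id; apply: eq_bigr => i _; case: ifP => // iF.
  have [->|ui] := eqVneq (u i) 0%N; first by rewrite !expr0.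
  by rewrite uF ?inE // in iF.
rewrite inE => ui iF; rewrite (bigD1 i) //= (negPf iF) expr0n (negPf ui).
by rewrite mul0r.
Qed.

Lemma restr_filt F p : restr F p = filt [pred G : {set 'I_n} | G \subset F] p.
Proof.
rewrite [in LHS](mpolyE p) rmorph_sum /= /filt [RHS]big_mkcond; apply: eq_bigr => u _ /=.
by rewrite restrZ restrXm; case: ifP => //; rewrite scaler0.
Qed.

Lemma mcoeff_restr F p u : (restr F p)@_u = if msup u \subset F then p@_u else 0.
Proof. by rewrite restr_filt mcoeff_filt. Qed.

Lemma restr_restr F G p : restr F (restr G p) = restr (F :&: G) p.
Proof. by apply/mpolyP => u; rewrite !mcoeff_restr subsetI; do 2!case: (_ \subset _). Qed.

Lemma restr_idem F p : restr F (restr F p) = restr F p.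
Proof. by rewrite restr_restr setIid. Qed.

Lemma restr_sub F G p : F \subset G -> restr F (restr G p) = restr F p.
Proof. by move=> /setIidPl FG; rewrite restr_restr FG. Qed.

Lemma restr_eq_sub F G p q : F \subset G -> restr G p = restr G q -> restr F p = restr F q.
Proof. by move=> FG E; rewrite -(restr_sub p FG) E restr_sub. Qed.

Lemma restr_fix F G p : F \subset G -> restr F p = p -> restr G p = p.
Proof. by move=> /setIidPr FG E; rewrite -E restr_restr FG. Qed.

Lemma restr_prodX F G :
  restr F (\prod_(i in G) 'X_i) = if G \subset F then \prod_(i in G) 'X_i else 0.
Proof.
rewrite rmorph_prod /=; case: ifP => [/subsetP GF|/subsetPn[i iG iF]].
  by apply: eq_bigr => i /GF iF; rewrite restrX iF.
by rewrite (bigD1 i) //= restrX (negPf iF) mul0r.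
Qed.

Lemma mpolyX_neq0 u : 'X_[u] != 0 :> S.
Proof. by rewrite -msupp_eq0 msuppX. Qed.

Lemma restr_congr (J : S -> Prop) F p :
  J 0 -> (forall a b, J a -> J b -> J (a + b)) -> (forall a b, J b -> J (a * b)) ->
  (forall i, i \notin F -> J 'X_i) -> J (p - restr F p).
Proof.
move=> J0 JD JM JX; rewrite -{1}[p](@msubst_id _ _ (fun i => 'X_i)) //.
apply: msubst_congr => // i; case: ifP => [_|/negbT/JX]; first by rewrite subrr.
by rewrite subr0.
Qed.

Lemma dvd_of_restr0 i p : restr [set~ i] p = 0 -> exists c, p = 'X_i * c.
Proof.
move=> p0; rewrite -[p]subr0 -p0.
apply: (@restr_congr (fun p => exists c, p = 'X_i * c)).
- by exists 0; rewrite mulr0.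
- by move=> _ _ [a ->] [b ->]; exists (a + b); rewrite mulrDr.
- by move=> a _ [b ->]; exists (a * b); rewrite mulrCA.
by move=> j; rewrite !inE negbK => /eqP ->; exists 1; rewrite mulr1.
Qed.

(** A monomial takes its coefficient from any face containing its support; agreement on
    intersections makes the choice harmless. *)
Lemma glue (J : finType) (F : J -> {set 'I_n}) (v : J -> S) :
  (forall i j, restr (F i :&: F j) (v i) = restr (F i :&: F j) (v j)) ->
  exists f, forall j, restr (F j) f = restr (F j) (v j).
Proof.
move=> vP; pose c G := [pick j | G \subset F j].
exists (\sum_j filt (fun G => c G == Some j) (v j)) => j.
apply/mpolyP => u; rewrite !mcoeff_restr; case: ifP => // uj.
rewrite raddf_sum /=; under eq_bigr do rewrite mcoeff_filt.
have [i ci] : exists i, c (msup u) = Some i.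
  by rewrite /c; case: pickP => [i _|/(_ j)]; [exists i|rewrite uj].
have ui : msup u \subset F i by move: ci; rewrite /c; case: pickP => // l ul [<-].
rewrite (bigD1 i) //= ci eqxx big1 ?addr0 => [|l li]; last first.
  by case: eqP => // -[il]; rewrite il eqxx in li.
have := congr1 (mcoeff u) (vP i j).
by rewrite !mcoeff_restr subsetI ui uj.
Qed.

Definition elem_sym (A : {set 'I_n}) (j : nat) : S :=
  \sum_(B : {set 'I_n} | (B \subset A) && (#|B| == j)) \prod_(i in B) 'X_i.

Lemma restr_elem_sym F A j : restr F (elem_sym A j) = elem_sym (A :&: F) j.
Proof.
rewrite /elem_sym rmorph_sum /= [LHS]big_mkcond [RHS]big_mkcond; apply: eq_bigr => B _.
rewrite restr_prodX subsetI andbAC.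
by case: (B \subset A); case: (B \subset F); case: (_ == j).
Qed.

Lemma elem_sym0 A : elem_sym A 0 = 1.
Proof.
rewrite /elem_sym (big_pred1 set0) ?big_set0 // => B.
by rewrite cards_eq0 /=; case: eqP => [->|]; rewrite ?sub0set ?andbF.
Qed.

Lemma elem_symS A a j : a \in A ->
  elem_sym A j.+1 = elem_sym (A :\ a) j.+1 + 'X_a * elem_sym (A :\ a) j.
Proof.
move=> aA; rewrite {1}/elem_sym (bigID (fun B : {set 'I_n} => a \in B)) /= addrC.
congr (_ + _).
  by apply: eq_bigl => B; rewrite subsetD1 andbAC.
rewrite (reindex_onto (fun B => a |: B) (fun B => B :\ a)) /=; last first.
  by move=> B /andP[_ aB]; exact: setD1K.
rewrite /elem_sym mulr_sumr; apply: eq_big => [B|B].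
  rewrite subUset sub1set aA /= setU11 andbT cardsU1 subsetD1.
  have [aB|aB] := boolP (a \in B); last by rewrite add1n eqSS setU1K // eqxx !andbT.
  rewrite andbF /=; apply/negP => /andP[_ /eqP E].
  by have := setD11 a (a |: B); rewrite E aB.
move=> /andP[_ /eqP E]; rewrite big_setU1 //.
by rewrite -E setD11.
Qed.

Lemma elem_sym_eq0 A j : (#|A| < j)%N -> elem_sym A j = 0.
Proof.
move=> Aj; rewrite /elem_sym big1 // => B /andP[/subset_leq_card BA /eqP Bj].
by move: Aj; rewrite -Bj ltnNge BA.
Qed.

Lemma mcoeff0_elem_sym A j : (elem_sym A j.+1)@_0%MM = 0.
Proof.
rewrite /elem_sym raddf_sum big1 // => B /andP[_ /eqP cB].
have /card_gt0P[x xB] : (0 < #|B|)%N by rewrite cB.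
by rewrite /= rmorph_prod (bigD1 x) //= mcoeffX mnm1_eq0 mul0r.
Qed.

(* Modulo the e_j of A, the e_j of A :\ v are the powers of - X_v, and they
   vanish for j = #|A|. *)
Lemma elem_sym_ideal_power (J : S -> Prop) A v :
  J 0 -> (forall a b, J a -> J b -> J (a + b)) -> (forall a b, J b -> J (a * b)) ->
  (forall j, J (elem_sym A j.+1)) -> v \in A -> J ('X_v ^+ #|A|).
Proof.
move=> J0 JD JM JA vA.
have JE j : J (elem_sym (A :\ v) j - (- 'X_v) ^+ j).
  elim: j => [|j IH]; first by rewrite elem_sym0 subrr.
  have -> : elem_sym (A :\ v) j.+1 - (- 'X_v) ^+ j.+1 =
      elem_sym A j.+1 + (- 'X_v) * (elem_sym (A :\ v) j - (- 'X_v) ^+ j).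
    by rewrite (elem_symS j vA) exprS; ring.
  by apply: JD => //; exact: (JM).
have := JE #|A|; rewrite elem_sym_eq0 ?sub0r; last first.
  by rewrite (cardsD1 v A) vA.
move=> /(JM (- (-1) ^+ #|A|)); rewrite [(- 'X_v) ^+ _]exprNn mulrNN mulrA.
by rewrite -exprMn mulrNN mulr1 expr1n mul1r.
Qed.

(* Modulo e_1 the polynomial e_2 is nonzero: setting X_a = - X_b and the other
   variables of A to zero turns it into - X_b^2. *)
Lemma elem_sym12_coprime A a b p q : a \in A -> b \in A -> a != b ->
  elem_sym A 1 * p = elem_sym A 2 * q -> exists c, q = elem_sym A 1 * c.
Proof.
move=> aA bA ab E; pose e1 := elem_sym (A :\ a) 1; pose e2 := elem_sym (A :\ a) 2.
have E1 : elem_sym A 1 = e1 + 'X_a by rewrite (elem_symS _ aA) elem_sym0 mulr1.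
have E2 : elem_sym A 2 = e2 + 'X_a * e1 by rewrite (elem_symS _ aA).
have baA : b \in A :\ a by rewrite !inE eq_sym ab.
have e1E : e1 = elem_sym (A :\ a :\ b) 1 + 'X_b by rewrite /e1 (elem_symS _ baA) elem_sym0 mulr1.
have e2E : e2 = elem_sym (A :\ a :\ b) 2 + 'X_b * elem_sym (A :\ a :\ b) 1.
  by rewrite /e2 (elem_symS _ baA).
(* [t] eliminates the variable of [a] by means of [elem_sym A 1 = 0]. Its values lie in a domain,
   and [t q = 0] will give divisibility of [q] by [elem_sym A 1]. *)
pose t : {rmorphism S -> S} := @msubst k n n (fun i => if i == a then - e1 else 'X_i).
have tfix (B : {set _}) j : a \notin B -> t (elem_sym B j) = elem_sym B j.
  move=> aB; rewrite /t /elem_sym rmorph_sum; apply: eq_bigr => C /andP[/subsetP CB _].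
  rewrite rmorph_prod; apply: eq_bigr => i /CB iB /=; rewrite msubstX.
  by case: eqP iB aB => // -> ->.
have aAa : a \notin A :\ a by rewrite !inE eqxx.
have t1 : t (elem_sym A 1) = 0.
  by rewrite E1 rmorphD /= tfix // /t msubstX eqxx subrr.
have t2 : t (elem_sym A 2) != 0.
  rewrite E2 rmorphD rmorphM /= !tfix // /t msubstX eqxx.
  apply: contraTneq (mpolyX_neq0 (U_(b) + U_(b))%MM) => /(congr1 (restr [set b])).
  have r0 j : restr [set b] (elem_sym (A :\ a :\ b) j.+1) = 0.
    rewrite restr_elem_sym (_ : _ :&: _ = set0) ?elem_sym_eq0 ?cards0 //.
    by apply/setP => i; rewrite !inE; case: (i == b); rewrite ?andbF.
  rewrite rmorphD rmorphM rmorphN /= rmorph0 -/e1 -/e2 e1E e2E !rmorphD rmorphM /= !r0.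
  rewrite restrX inE eqxx mulr0 !add0r mulNr => /eqP.
  by rewrite oppr_eq0 mpolyXD => ->.
have tq : t q = 0.
  apply/eqP; have /(congr1 t)/eqP := E; rewrite !rmorphM /= t1 mul0r eq_sym mulf_eq0.
  by rewrite (negPf t2).
rewrite -[q]subr0 -tq -{1}[q](@msubst_id _ _ (fun i => 'X_i)) //.
apply: (@msubst_congr _ _ _ (fun x => exists c, x = elem_sym A 1 * c)).
- by exists 0; rewrite mulr0.
- by move=> _ _ [x ->] [y ->]; exists (x + y); rewrite mulrDr.
- by move=> x _ [y ->]; exists (x * y); rewrite mulrCA.
move=> i; case: eqP => [->|_]; last by exists 0; rewrite subrr mulr0.
by exists 1; rewrite E1; ring.
Qed.

End Restriction.

(** * Localizations of quotients *)

(* iota : S -> A exhibits A as the localization at P of a quotient S / I. *)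
Record local_quotient (S A : comNzRingType) (iota : {rmorphism S -> A})
    (I P : S -> Prop) : Prop := LocalQuotient {
  lq_prime : prime_pred P;
  lq_ker : forall f, iota f = 0 <-> exists2 u, ~ P u & I (u * f);
  lq_unit : forall s, ~ P s -> exists y, iota s * y = 1;
  lq_frac : forall x, exists f s, ~ P s /\ iota s * x = iota f;
  lq_maximal : forall f, P f -> in_maximal (iota f) }.

Definition comb (S : comNzRingType) (xs : seq S) (c : nat -> S) : S :=
  \sum_(i < size xs) c i * xs`_i.

Section LocalQuotient.
Variables (S A : comNzRingType) (iota : {rmorphism S -> A}) (I P : S -> Prop).
Hypothesis lq : local_quotient iota I P.
Let prP := lq_prime lq.

Lemma lq_ker_sub f : I f -> iota f = 0.
Proof. by move=> If; apply/(lq_ker lq); exists 1; rewrite ?mul1r //; exact: (prime_pred1 prP). Qed.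

Lemma lq_unit_reg s x y : ~ P s -> iota s * x = iota s * y -> x = y.
Proof.
move=> /(lq_unit lq)[z sz] E.
by rewrite -[x]mul1r -[y]mul1r -sz mulrC mulrA [x * _]mulrC E; ring.
Qed.

Lemma lq_eq f g : iota f = iota g <-> exists2 u, ~ P u & I (u * (f - g)).
Proof.
rewrite -(lq_ker lq) rmorphB; split=> [->|/eqP]; first by rewrite subrr.
by rewrite subr_eq0 => /eqP.
Qed.

Lemma lq_maximalE s f x : ~ P s -> iota s * x = iota f -> in_maximal x -> P f.
Proof.
move=> Ns E mx; apply: contrapT => /(lq_unit lq)[y fy].
by apply: mx; exists (iota s * y); rewrite mulrA [x * _]mulrC E.
Qed.

Lemma lq_common_denominator (c : nat -> A) (m : nat) :
  exists s g, ~ P s /\ forall i, (i < m)%N -> iota s * c i = iota (g i).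
Proof.
elim: m => [|m [s [g [Ns sg]]]].
  by exists 1, (fun=> 0); split=> //; exact: (prime_pred1 prP).
have [f [t [Nt tf]]] := lq_frac lq (c m).
exists (s * t), (fun i => if (i < m)%N then t * g i else s * f).
split=> [|i]; first exact: prime_predNM.
rewrite ltnS leq_eqVlt => /orP[/eqP->|im].
  by rewrite ltnn !rmorphM -mulrA tf.
by rewrite im !rmorphM -sg //; ring.
Qed.

(** Clearing the denominators of finitely many coefficients turns membership in the localization
    into membership in S up to a multiplier outside [P]. *)
Lemma ideal_genE xs f :
  ideal_gen [seq iota x | x <- xs] (iota f) <->
  exists u c, ~ P u /\ I (u * f - comb xs c).
Proof.
rewrite /ideal_gen size_map; split=> [[c fE]|[u [c [Nu If]]]].
  pose c' i := if insub i is Some j then c j else 0.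
  have [s [g [Ns sg]]] := lq_common_denominator c' (size xs).
  have /lq_ker -/(_ _ _ lq)[u Nu] : iota (s * f - comb xs g) = 0.
    rewrite rmorphB rmorphM fE rmorph_sum mulr_sumr -sumrB big1 // => i _.
    by rewrite rmorphM -sg // (nth_map 0) // /c' valK mulrA subrr.
  rewrite mulrBr /comb mulr_sumr => If; exists (u * s), (fun i => u * g i).
  split; first exact: prime_predNM.
  rewrite -mulrA; congr (I (_ - _)): If; apply: eq_bigr => i _; exact: mulrA.
have [y uy] := lq_unit lq Nu.
exists (fun i => y * iota (c i)).
have /eqP := lq_ker_sub If; rewrite rmorphB subr_eq0 rmorphM => /eqP E.
rewrite -[iota f]mul1r -uy mulrAC E [_ * y]mulrC rmorph_sum mulr_sumr.
apply: eq_bigr => i _; rewrite rmorphM (nth_map 0) // mulrA //.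
Qed.

(** Primes of the localization contract to primes between [I] and [P]; a strict inclusion is
    witnessed by a numerator, as denominators are units. *)
Lemma krull_dim_ge_chain d : krull_dim_ge A d ->
  exists Q : nat -> S -> Prop,
    (forall i, (i <= d)%N -> [/\ prime_pred (Q i), forall f, I f -> Q i f
                          & forall f, Q i f -> P f]) /\
    forall i, (i < d)%N -> (forall f, Q i f -> Q i.+1 f) /\
                          exists2 f, Q i.+1 f & ~ Q i f.
Proof.
move=> [p pP]; exists (fun i f => iota f \in (p (inord i) : pred A)); split=> [i id|i id].
  split=> [|f If|f Qf].
  - split=> [||f g Qf Qg|f g Qg|f g].
    + by rewrite rmorph0 idealr0.
    + by rewrite rmorph1 idealr1.
    + by rewrite rmorphD rpredD.
    + by rewrite rmorphM idealMr.
    + by rewrite rmorphM prime_idealrM => /orP.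
  - by rewrite lq_ker_sub // idealr0.
  apply: contrapT => /(lq_unit lq)[y fy].
  by have := idealMr y Qf; rewrite mulrC fy idealr1.
have lti : (@inord d i < @inord d i.+1)%N by rewrite !inordK // ltnS ltnW.
have [sub Nsub] := pP _ _ lti; split=> [f|]; first exact: sub.
have [x xp Nx] : exists2 x, x \in (p (inord i.+1) : pred A) & x \notin (p (inord i) : pred A).
  apply: contrapT => /forall2NP H; apply: Nsub => x xp.
  by case: (H x) => // /negP; rewrite negbK.
have [f [s [Ns E]]] := lq_frac lq x; exists f; rewrite -E; first exact: idealMr.
rewrite prime_idealrM => /orP[Qs|]; last exact/negP.
have [y sy] := lq_unit lq Ns.
by have := idealMr y Qs; rewrite mulrC sy idealr1.
Qed.

Section Extension.
Variable Q : S -> Prop.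
Hypotheses (prQ : prime_pred Q) (IQ : forall f, I f -> Q f) (QP : forall f, Q f -> P f).

Definition extension : {pred A} :=
  fun x => `[< exists f s, [/\ ~ P s, Q f & iota s * x = iota f] >].

(** Any fraction representing [x] decides membership: two of them agree modulo [I] up to a
    multiplier outside [P], and [Q] lies between [I] and [P]. *)
Lemma extensionE s f x : ~ P s -> iota s * x = iota f -> (x \in extension) <-> Q f.
Proof.
move=> Ns E; split=> [/asboolP[g [t [Nt Qg E']]]|Qf]; last by apply/asboolP; exists f, s.
have /lq_eq[u Nu] : iota (t * f) = iota (s * g) by rewrite !rmorphM -E -E'; ring.
move=> /IQ; rewrite mulrBr => /(prime_predD prQ)/(_ (prime_predMl prQ u (prime_predMl prQ s Qg))).
by rewrite subrK => /(prime_predM prQ)[/QP//|/(prime_predM prQ)[/QP//|//]].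
Qed.

Lemma extension_closed : idealr_closed extension.
Proof.
have N1 := prime_pred1 prP.
split.
- by apply/(extensionE (s := 1) (f := 0)) => //; rewrite ?mulr0 ?rmorph0 //; exact: (prime_pred0 prQ).
- apply/negP => /(extensionE (s := 1) (f := 1)) => H.
  by apply: (prime_pred1 prQ); apply: H; rewrite ?mulr1.
- move=> a x y /asboolP[f [s [Ns Qf E]]] /asboolP[g [t [Nt Qg E']]].
  have [h [v [Nv E'']]] := lq_frac lq a.
  apply/asboolP; exists (t * h * f + v * s * g), (v * s * t); split.
  - by do 2!apply: prime_predNM => //.
  - by apply: (prime_predD prQ); apply: (prime_predMl prQ).
  by rewrite rmorphD !rmorphM -E -E' -E''; ring.
Qed.

Lemma extension_prime : prime_idealr_closed extension.
Proof.
move=> x y; have [f [s [Ns E]]] := lq_frac lq x; have [g [t [Nt E']]] := lq_frac lq y.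
have E'' : iota (s * t) * (x * y) = iota (f * g) by rewrite !rmorphM -E -E'; ring.
move/(extensionE (prime_predNM prP Ns Nt) E'')/(prime_predM prQ).
by case=> [/(extensionE Ns E)->//|/(extensionE Nt E')->]; rewrite orbT.
Qed.

End Extension.

Lemma chain_krull_dim_ge d (Q : nat -> S -> Prop) :
  (forall i, (i <= d)%N -> [/\ prime_pred (Q i), forall f, I f -> Q i f
                          & forall f, Q i f -> P f]) ->
  (forall i, (i < d)%N -> (forall f, Q i f -> Q i.+1 f) /\
                          exists2 f, Q i.+1 f & ~ Q i f) ->
  krull_dim_ge A d.
Proof.
move=> QP Qlt.
have N1 := prime_pred1 prP.
have Qi (i : 'I_d.+1) := QP i (leq_ord i).
pose p (i : 'I_d.+1) : prime_idealr A :=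
  let: And3 prQ IQ QP := Qi i in
  HB.pack_for (prime_idealr A) (extension (Q i))
    (isIdealr.Build A (extension (Q i)) (extension_closed prQ IQ QP))
    (isPrimeIdealrClosed.Build A (extension (Q i)) (extension_prime prQ IQ QP)).
have pE i : (p i : pred A) = extension (Q i) by rewrite /p; case: (Qi i).
exists p => i j ij; rewrite !pE.
have Qmono l : (l <= d - i)%N -> forall f, Q i f -> Q (i + l)%N f.
  elim: l => [|l IH] ld f Qf; first by rewrite addn0.
  have lt : (i + l < d)%N by rewrite -ltn_subRL.
  by rewrite addnS; apply: (Qlt _ lt).1; apply: IH => //; exact: ltnW.
have {}Qmono a b : (i <= a)%N -> (a <= b)%N -> (b <= d)%N -> forall f, Q a f -> Q b f.
  move=> _ ab; move: (subnKC ab) => <-; elim: (b - a)%N => [|l IH] bd f Qf.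
    by rewrite addn0.
  rewrite addnS in bd *; apply: (Qlt _ bd).1; apply: IH => //; exact: ltnW.
split=> [x /asboolP[f [s [Ns Qf E]]]|sub].
  apply/asboolP; exists f, s; split=> //.
  by apply: (Qmono i j) => //; [exact: ltnW|rewrite leq_ord].
have [|sub1 [f Qf Nf]] := Qlt i; first exact: leq_trans ij (leq_ord j).
have [prQ IQ QPi] := Qi i.
apply: Nf; apply/(extensionE prQ IQ QPi (s := 1) (x := iota f)) => //.
  by rewrite rmorph1 mul1r.
apply: sub; apply/asboolP; exists f, 1; split=> //; last by rewrite rmorph1 mul1r.
by apply: (Qmono i.+1 j) => //; rewrite leq_ord.
Qed.

(** Here and in [lq_depth_ge2] regularity is tested on numerators in S; multipliers outside [P]
    become units. *)
Lemma lq_depth_ge1 x : P x ->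
  (forall a, I (x * a) -> exists2 w, ~ P w & I (w * a)) ->
  depth_ge A 1.
Proof.
move=> Px reg; exists [:: iota x]; split=> [//|y|[|//] a _].
  by rewrite inE => /eqP ->; exact: (lq_maximal lq).
move=> /= [c]; rewrite big_ord0 => xa; exists c; rewrite big_ord0.
have [f [s [Ns E]]] := lq_frac lq a.
have /(lq_ker lq)[u Nu] : iota (x * f) = 0.
  by rewrite rmorphM -E mulrCA xa mulr0.
rewrite mulrCA => /reg[w Nw]; rewrite mulrA => Iw.
apply: (lq_unit_reg Ns); rewrite mulr0 E; apply/(lq_ker lq).
by exists (w * u) => //; exact: prime_predNM.
Qed.

Lemma lq_depth_ge2 x y : P x -> P y ->
  (forall a, I (x * a) -> exists2 w, ~ P w & I (w * a)) ->
  (forall a c, I (y * a - x * c) -> exists w b, ~ P w /\ I (w * a - x * b)) ->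
  depth_ge A 2.
Proof.
move=> Px Py reg1 reg2; exists [:: iota x; iota y]; split=> [//|z|].
  by rewrite !inE => /orP[]/eqP ->; exact: (lq_maximal lq).
move=> [|[|//]] a _ /=.
  move=> [c]; rewrite big_ord0 => xa; exists c; rewrite big_ord0.
  have [f [s [Ns E]]] := lq_frac lq a.
  have /(lq_ker lq)[u Nu] : iota (x * f) = 0.
    by rewrite rmorphM -E mulrCA xa mulr0.
  rewrite mulrCA => /reg1[w Nw]; rewrite mulrA => Iw.
  apply: (lq_unit_reg Ns); rewrite mulr0 E; apply/(lq_ker lq).
  by exists (w * u) => //; exact: prime_predNM.
have [f [s [Ns E]]] := lq_frac lq a.
rewrite -[[:: iota x]]/[seq iota z | z <- [:: x]] => -[c cE].
have /ideal_genE[u [e [Nu]]] : ideal_gen [seq iota z | z <- [:: x]] (iota (y * f)).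
  exists (fun i => iota s * c i); rewrite rmorphM -E mulrCA cE mulr_sumr.
  by apply: eq_bigr => i _; exact: mulrA.
rewrite /comb /= big_ord1 /= mulrCA [e 0%N * x]mulrC => /reg2[w [b [Nw]]].
rewrite mulrA => Iw.
have /ideal_genE[g gE] : exists u c, ~ P u /\ I (u * f - comb [:: x] c).
  exists (w * u), (fun=> b); split; first exact: prime_predNM.
  by rewrite /comb /= big_ord1 /= [b * x]mulrC.
have [t st] := lq_unit lq Ns.
exists (fun i => t * g i).
rewrite -[a]mul1r -st mulrAC E [_ * t]mulrC gE mulr_sumr.
by apply: eq_bigr => i _; exact: mulrA.
Qed.

End LocalQuotient.

(** * The canonical map to the localization *)

Section FractionMap.
Variables (R : comNzRingType) (p : prime_idealr R).
Local Notation L := (Localization.type p).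

Definition frac_of (a : R) (s : Localization.denom p) : localization p := \pi_L (a, s).

Lemma frac_of_eq a b s t : frac_of a s = frac_of b t <->
  exists u : Localization.denom p, sval u * (a * sval t) = sval u * (b * sval s).
Proof.
split=> [/eqP/Localization.eqP_frac[u E]|[u E]]; first by exists u.
by apply/eqP/Localization.eqP_frac; exists u.
Qed.

Lemma frac_ofM a b s t : frac_of a s * frac_of b t = frac_of (a * b) (Localization.denomM s t).
Proof. exact: esym (Localization.pi_mul (a, s) (b, t)). Qed.

Lemma frac_ofD a b s t : frac_of a s + frac_of b t =
  frac_of (a * sval t + b * sval s) (Localization.denomM s t).
Proof. exact: esym (Localization.pi_add (a, s) (b, t)). Qed.

Lemma frac_of0 : frac_of 0 (Localization.denom1 p) = 0.
Proof. by rewrite -[RHS]/(Localization.zero p) /Localization.zero; unlock. Qed.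

Lemma frac_of1 : frac_of 1 (Localization.denom1 p) = 1.
Proof. by rewrite -[RHS]/(Localization.one p) /Localization.one; unlock. Qed.

Lemma frac_ofP (x : localization p) : exists a s, x = frac_of a s.
Proof. by exists (repr (x : L)).1, (repr (x : L)).2; rewrite /frac_of -surjective_pairing reprK. Qed.

Definition to_loc (a : R) : localization p := frac_of a (Localization.denom1 p).

Lemma to_locD : {morph to_loc : a b / a + b}.
Proof.
move=> a b; rewrite /to_loc frac_ofD; apply/frac_of_eq; exists (Localization.denom1 p).
by rewrite /= !mulr1.
Qed.

Lemma to_locM : {morph to_loc : a b / a * b}.
Proof.
move=> a b; rewrite /to_loc frac_ofM; apply/frac_of_eq; exists (Localization.denom1 p).
by rewrite /= !mulr1.
Qed.

Lemma to_loc_zmod_morphism : zmod_morphism to_loc.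
Proof.
have to_locN a : to_loc (- a) = - to_loc a.
  by apply/eqP; rewrite -addr_eq0 -to_locD addNr /to_loc frac_of0.
by move=> a b; rewrite to_locD to_locN.
Qed.

Lemma to_loc_monoid_morphism : monoid_morphism to_loc.
Proof. by split; [exact: frac_of1|exact: to_locM]. Qed.

HB.instance Definition _ := GRing.isZmodMorphism.Build R (localization p) to_loc
  to_loc_zmod_morphism.
HB.instance Definition _ := GRing.isMonoidMorphism.Build R (localization p) to_loc
  to_loc_monoid_morphism.

End FractionMap.

Section FaceRing.
Variables (k : fieldType) (n : nat) (D : simplicial_complex n).
Local Notation S := {mpoly k[n]}.
Local Notation R := (sr_ring k D).
Variable p : prime_idealr R.

Definition sr_proj_morph : {rmorphism S -> R} := \pi_{ideal_quot (sr_ideal D)}.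

Definition local_iota : {rmorphism S -> localization p} := (@to_loc R p) \o sr_proj_morph.

Definition sr_prime (f : S) : Prop := sr_proj_morph f \in (p : pred R).

Definition sr_pred (f : S) : Prop := f \in sr_ideal (k := k) D.

Lemma sr_proj_eq0 f : sr_proj_morph f = 0 <-> sr_pred f.
Proof.
rewrite -(rmorph0 sr_proj_morph) /sr_pred -[f in f \in _]subr0.
by rewrite Quotient.idealrBE; split=> /eqP.
Qed.

Lemma sr_prime_pred : prime_pred sr_prime.
Proof.
have H : prime_pred (fun a => a \in (p : pred R)).
  split=> [||f g Qf Qg|f g Qg|f g].
  + by rewrite idealr0.
  + by rewrite idealr1.
  + by rewrite rpredD.
  + by rewrite idealMr.
  + by rewrite prime_idealrM => /orP.
exact: (prime_pred_preim sr_proj_morph H).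
Qed.

Lemma sr_projP (a : R) : exists f, a = sr_proj_morph f.
Proof. by elim/quotW: a => f; exists f. Qed.

(** This bridge lets the later arguments at a prime of the face ring be made with polynomials. *)
Lemma sr_local_quotient : local_quotient local_iota sr_pred sr_prime.
Proof.
split.
- exact: sr_prime_pred.
- move=> f; rewrite -(rmorph0 local_iota) /= /to_loc frac_of_eq rmorph0 /=.
  split=> [[[u Nu] /=]|[u Nu /sr_proj_eq0]].
    have [v vE] := sr_projP u; rewrite mulr1 mul0r mulr0 => uf; exists v.
      by rewrite /sr_prime -vE; apply/negP.
    by apply/sr_proj_eq0; rewrite rmorphM -vE.
  move/negP: Nu => Nu; rewrite rmorphM => uf.
  by exists (Sub (sr_proj_morph u) Nu); rewrite /= mulr1 mul0r mulr0.
- move=> s /negP Ns; exists (frac_of 1 (Sub (sr_proj_morph s) Ns)).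
  rewrite /= /to_loc frac_ofM -frac_of1; apply/frac_of_eq.
  by exists (Localization.denom1 p); rewrite /= !mulr1 !mul1r.
- move=> x; have [a [[s Ns] ->]] := frac_ofP x.
  have [f fE] := sr_projP a; have [t tE] := sr_projP s; exists f, t; split.
    by rewrite /sr_prime -tE; apply/negP.
  rewrite /= /to_loc frac_ofM; apply/frac_of_eq; exists (Localization.denom1 p).
  by rewrite /= fE tE !mulr1 !mul1r mulrC.
- move=> f Pf [y]; have [a [[s Ns] ->]] := frac_ofP y.
  rewrite /= /to_loc frac_ofM -frac_of1 => /frac_of_eq[[u Nu] /=].
  rewrite !mulr1 !mul1r => E; move: (prime_idealrM p u s).
  rewrite -E (negPf Nu) (negPf Ns) /= => Nfa.
  have : u * (sr_proj_morph f * a) \in (p : pred R) by rewrite idealMr // mulrC idealMr.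
  by rewrite Nfa.
Qed.

End FaceRing.

(** * Serre's condition S_2 *)

(* Keeps unification from unfolding these down to big operators. *)
Opaque restr msubst elem_sym.

(** If a polynomial vanishes on all faces, each of its monomials has a nonface as support, so it is
    a multiple of a squarefree generator of the face ideal. *)
Lemma sr_predP (k : fieldType) (n : nat) (D : simplicial_complex n) (f : {mpoly k[n]}) :
  sr_pred D f <-> forall F, F \in (D : {set {set 'I_n}}) -> restr F f = 0.
Proof.
split=> [/asboolP[c ->] F FD|f0].
  rewrite rmorph_sum big1 // => G GD; rewrite rmorphM /= restr_prodX.
  by case: ifP => [/face_sub/(_ FD)|_]; rewrite ?(negPf GD) // mulr0.
have gen G : G \notin (D : {set {set 'I_n}}) -> sr_pred D (\prod_(i in G) 'X_i : {mpoly k[n]}).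
  move=> GD; apply/asboolP; exists (fun F => (F == G)%:R); rewrite (bigD1 G) //= eqxx mul1r.
  by rewrite [X in _ + X]big1 ?addr0 // => F /andP[_ /negPf ->]; rewrite mul0r.
rewrite /sr_pred [f]mpolyE big_seq; apply: rpred_sum => u uf.
rewrite -mul_mpolyC; apply: idealMr.
have uD : msup u \notin (D : {set {set 'I_n}}).
  apply/negP => /f0/(congr1 (mcoeff u)); rewrite mcoeff_restr subxx mcoeff0 => /eqP.
  by rewrite mcoeff_eq0 uf.
have -> : 'X_[u] = (\prod_i 'X_i ^+ (u i).-1) * \prod_(i in msup u) 'X_i :> {mpoly k[n]}.
  rewrite mpolyXE_id [X in _ * X]big_mkcond -big_split; apply: eq_bigr => i _ /=.
  by rewrite inE; case: (u i) => [|e]; rewrite ?mulr1 // -exprSr.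
by apply: idealMr; exact: gen.
Qed.

Section ElemSymMore.
Variables (k : idomainType) (n : nat).
Implicit Types (A : {set 'I_n}).

Lemma elem_sym_set1 (a : 'I_n) : elem_sym k [set a] 1 = 'X_a.
Proof.
by rewrite (elem_symS _ _ (set11 a)) elem_sym0 mulr1 elem_sym_eq0 ?add0r // setDv cards0.
Qed.

Lemma elem_sym1_neq0 A : A != set0 -> elem_sym k A 1 != 0.
Proof.
move=> /set0Pn[a aA]; apply: contraTneq (mpolyX_neq0 k U_(a)%MM) => /(congr1 (restr [set a])).
rewrite restr_elem_sym rmorph0 (_ : A :&: [set a] = [set a]) ?elem_sym_set1 => [->|].
  by rewrite eqxx.
by apply/setIidPr; rewrite sub1set.
Qed.

Lemma prime_pred_elem_sym (P : {mpoly k[n]} -> Prop) A j :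
  prime_pred P -> (forall i, i \in A -> P 'X_i) -> P (elem_sym k A j.+1).
Proof.
move=> prP PA; apply: (prime_pred_sum prP) => B /andP[/subsetP BA /eqP Bj].
have /card_gt0P[i iB] : (0 < #|B|)%N by rewrite Bj.
by rewrite (bigD1 i) //=; apply: (prime_predMr prP); apply: PA; exact: BA.
Qed.

Lemma prime_pred_restr (P : {mpoly k[n]} -> Prop) (F : {set 'I_n}) f :
  prime_pred P -> (forall i, i \notin F -> P 'X_i) -> P (restr F f) <-> P f.
Proof.
move=> prP PF; have H : P (f - restr F f).
  apply: restr_congr => //; [exact: (prime_pred0 prP)|exact: (prime_predD prP)|].
  exact: (prime_predMl prP).
split=> [Pr|Pf]; first by rewrite -[f](subrK (restr F f)); exact: (prime_predD prP).
by have := prime_predB prP Pf H; rewrite subKr.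
Qed.

End ElemSymMore.

(** Identifies the image of [restr F] with a polynomial ring in [#|F|] variables, to which the
    trichotomy and the dimension bound apply. *)
Lemma face_ring_retract (k : fieldType) (n : nat) (F : {set 'I_n}) :
  exists (j : {rmorphism {mpoly k[#|F|]} -> {mpoly k[n]}})
         (r : {rmorphism {mpoly k[n]} -> {mpoly k[#|F|]}}),
    (forall f, r (j f) = f) /\ (forall f, j (r f) = restr F f).
Proof.
pose j : {rmorphism _ -> _} := @msubst k #|F| n (fun i => 'X_(enum_val i)).
pose r : {rmorphism _ -> _} := @msubst k n #|F| (fun i =>
  if [pick l : 'I_#|F| | enum_val l == i] is Some l then 'X_l else 0).
exists j, r; split=> f.
  rewrite /j /r /= msubst_comp msubst_id // => i; rewrite /= msubstX.
  case: pickP => [l /eqP/enum_val_inj -> //|/(_ i)]; by rewrite eqxx.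
rewrite /j /r /= msubst_comp.
apply: (mpoly_rmorph_ext (f := msubst _) (g := restr F)) => [c|i] /=.
  by rewrite msubstC restrC.
rewrite msubstX restrX /=; case: pickP => [l /eqP <-|N].
  by rewrite msubstX enum_valP.
case: ifP => [iF|]; last by rewrite rmorph0.
by have := N (enum_rank_in iF i); rewrite enum_rankK_in ?eqxx.
Qed.

(** The chain excludes two cases of the trichotomy in the variables of [F]: there [Q1] is nonzero
    because it exceeds [Q0], and it is strictly below [P], which rules out a uniformizer. *)
Lemma prime_chain_regular_pair (k : fieldType) (n : nat) (F : {set 'I_n})
    (P Q0 Q1 Q2 : {mpoly k[n]} -> Prop) :
  prime_pred P -> prime_pred Q1 ->
  (forall i, i \notin F -> Q0 'X_i) -> prime_pred Q0 ->
  (forall f, Q0 f -> Q1 f) -> (forall f, Q1 f -> Q2 f) -> (forall f, Q2 f -> P f) ->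
  (exists2 f, Q1 f & ~ Q0 f) -> (exists2 f, Q2 f & ~ Q1 f) ->
  exists g1 g2, [/\ P g1, P g2, restr F g1 = g1, restr F g2 = g2 & g2 <> 0 /\
    forall a b, restr F a = a -> restr F b = b -> g1 * a = g2 * b ->
      exists w c, [/\ ~ P w, restr F c = c & w * a = g2 * c]].
Proof.
move=> prP prQ1 XQ0 prQ0 Q01 Q12 Q2P [f1 Q1f1 N1] [f2 Q2f2 N2].
have [j [r [jK rK]]] := face_ring_retract k F.
have rF f : restr F (j f) = j f by rewrite -rK jK.
have jrf (Q : {mpoly k[n]} -> Prop) f : prime_pred Q -> (forall g, Q0 g -> Q g) ->
    Q (j (r f)) <-> Q f.
  by move=> prQ Q0Q; rewrite rK; apply: prime_pred_restr => // i /XQ0/Q0Q.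
have rf1 : r f1 <> 0.
  by move=> E; apply: N1; apply/(jrf Q0) => //; rewrite E rmorph0; exact: (prime_pred0 prQ0).
have Q0P f : Q0 f -> P f by move/Q01/Q12/Q2P.
have Q1P f : Q1 f -> P f by move/Q12/Q2P.
have prPj := prime_pred_preim j prP.
case: (prime_trichotomy_mpoly prPj) => [P0|dv|[g1 [g2 [P1 P2 g20 reg]]]].
- by case: rf1; apply: P0; apply/(jrf P) => //; exact: Q1P.
- case: N2; apply/(jrf Q1) => //.
  apply: (dvr_at_no_between prPj (prime_pred_preim j prQ1) dv) => /=.
  + by move=> f /Q1P.
  + by exists (r f1) => //; apply/(jrf Q1).
  by apply/(jrf P) => //; exact: Q2P.
exists (j g1), (j g2); split=> //; split=> [E|a b aF bF E].
  by apply: g20; rewrite -[g2]jK E rmorph0.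
have [|w [c [Nw Ew]]] := reg (r a) (r b).
  by rewrite -[g1]jK -rmorphM E rmorphM jK.
by exists (j w), (j c); split=> //; rewrite -[in LHS]aF -rK -!rmorphM Ew.
Qed.

(** * Serre's condition from facets connected through ridges *)

Section S2Criterion.
Variables (n d : nat) (D : simplicial_complex n) (J : finType) (F : J -> {set 'I_n}).
Hypothesis DF : forall G, (G \in (D : {set {set 'I_n}})) <-> exists j, G \subset F j.
Hypothesis cardF : forall j, #|F j| = d.
(* Any equivalence relation identifying facets with a common ridge through H
   identifies all facets through H; allowing codimension zero is harmless. *)
Hypothesis connF : forall (H : {set 'I_n}) (e : J -> J -> Prop),
  (forall i, e i i) -> (forall i j, e i j -> e j i) ->
  (forall i j l, e i j -> e j l -> e i l) ->
  (forall i j, H \subset F i :&: F j -> (d <= #|F i :&: F j|.+1)%N -> e i j) ->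
  forall i j, H \subset F i -> H \subset F j -> e i j.

Lemma sr_facetP (k : fieldType) (f : {mpoly k[n]}) :
  sr_pred D f <-> forall j, restr (F j) f = 0.
Proof.
rewrite sr_predP; split=> [f0 j|f0 G /DF[j Gj]].
  by apply: f0; apply/DF; exists j.
by rewrite -(restr_sub f Gj) f0 rmorph0.
Qed.

Section AtPrime.
Variables (k : fieldType) (P : {mpoly k[n]} -> Prop).
Hypotheses (prP : prime_pred P) (IP : forall f, sr_pred D f -> P f).
Local Notation S := {mpoly k[n]}.

(** The product of the variables outside [Q] is outside [Q], hence outside the face ideal, so these
    variables form a face. *)
Lemma prime_face (Q : S -> Prop) : prime_pred Q -> (forall f, sr_pred D f -> Q f) ->
  exists j, forall i, i \notin F j -> Q 'X_i.
Proof.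
move=> prQ IQ; pose G := [set i | `[< ~ Q 'X_i >]].
have NG : ~ Q (\prod_(i in G) 'X_i).
  by move/(prime_pred_prod prQ) => [i]; rewrite inE => /asboolP.
have [j Gj] : exists j, G \subset F j.
  apply/DF; apply: contrapT => /negP GD; apply: NG; apply: IQ; apply/sr_predP => H HD.
  rewrite restr_prodX; case: ifP => // GH; case/negP: GD; exact: face_sub HD.
exists j => i iF; apply: contrapT => NQ; case/negP: iF; apply: (subsetP Gj).
by rewrite inE; apply/asboolP.
Qed.

(** The variables that become units at [P]; [locked] keeps simplification from unfolding the set. *)
Let G := locked [set i | `[< ~ P 'X_i >]].

Let in_G i : (i \in G) = `[< ~ P 'X_i >].
Proof. by rewrite /G -lock inE. Qed.

Let GP i : i \notin G -> P 'X_i.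
Proof. by rewrite in_G => /asboolP/contrapT. Qed.

Let NPG : ~ P (\prod_(i in G) 'X_i).
Proof. by move/(prime_pred_prod prP) => [i]; rewrite in_G => /asboolP. Qed.

Let sub_G (H : {set 'I_n}) : (forall i, i \notin H -> P 'X_i) -> G \subset H.
Proof.
by move=> PH; apply/subsetP => i; rewrite in_G => /asboolP Ni; apply: contrapT => /negP/PH.
Qed.

Let restr_prodG j : ~~ (G \subset F j) -> restr (F j) (\prod_(i in G) 'X_i : S) = 0.
Proof. by rewrite restr_prodX => /negPf ->. Qed.

(** The monomial of [G], a unit at [P], kills everything on facets not containing [G]; on the other
    facets [x] is cancelled. *)
Let cop1 (x : S) : (forall j, G \subset F j -> restr (F j) x != 0) ->
  forall a, sr_pred D (x * a) -> exists2 w, ~ P w & sr_pred D (w * a).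
Proof.
move=> xN0 a /sr_facetP xa; exists (\prod_(i in G) 'X_i) => //; apply/sr_facetP => j.
have [Gj|Gj] := boolP (G \subset F j); last by rewrite rmorphM /= restr_prodG // mul0r.
have /eqP := xa j; rewrite !rmorphM mulf_eq0 (negPf (xN0 _ Gj)) => /eqP ->.
by rewrite mulr0.
Qed.

(** Divisibility by [x] on each facet through [G] suffices: the quotients agree on ridges, where [x]
    is nonzero, hence on all intersections through [G] by connectedness, and they glue. *)
Let cop2 (x y : S) :
  (forall i j, G \subset F i :&: F j -> (d <= #|F i :&: F j|.+1)%N ->
    restr (F i :&: F j) x != 0) ->
  (forall a c, sr_pred D (y * a - x * c) -> exists2 w, ~ P w &
     forall j, G \subset F j -> exists b, restr (F j) (w * a) = restr (F j) (x * b)) ->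
  forall a c, sr_pred D (y * a - x * c) -> exists w b, ~ P w /\ sr_pred D (w * a - x * b).
Proof.
move=> xN0 cop a c /cop[w Nw bP].
have /choice[b {}bP] : forall j, exists b, G \subset F j -> restr (F j) (w * a) = restr (F j) (x * b).
  move=> j; have [Gj|Gj] := boolP (G \subset F j); last by exists 0.
  by have [b E] := bP j Gj; exists b.
pose XG : S := \prod_(i in G) 'X_i.
have [i j|f fP] := @glue k n J F (fun j => XG * b j).
  rewrite !rmorphM /=.
  have [Gij|Gij] := boolP (G \subset F i :&: F j); last first.
    by rewrite /XG restr_prodX (negPf Gij) !mul0r.
  suff -> : restr (F i :&: F j) (b i) = restr (F i :&: F j) (b j) by [].
  have [Hi Hj] := (subsetIl (F i) (F j), subsetIr (F i) (F j)).
  apply: (@connF _ (fun l m => restr (F i :&: F j) (b l) = restr (F i :&: F j) (b m))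
    (fun=> erefl) (fun _ _ => @esym _ _ _) (fun _ _ _ => @etrans _ _ _ _) _ i j Hi Hj).
  move=> l m Hlm dlm; apply: (restr_eq_sub Hlm).
  have Glm := subset_trans Gij Hlm.
  apply: (mulfI (xN0 l m Glm dlm)).
  have [Gl Gm] := subsetIP Glm.
  have := restr_eq_sub (subsetIl (F l) (F m)) (bP l Gl).
  have := restr_eq_sub (subsetIr (F l) (F m)) (bP m Gm).
  by rewrite !rmorphM /= => -> ->.
exists (XG * w), f; split; first exact: prime_predNM.
apply/sr_facetP => j; rewrite rmorphB -mulrA !rmorphM /= fP rmorphM /=.
have [Gj|Gj] := boolP (G \subset F j); last by rewrite restr_prodG // !mul0r mulr0 subrr.
by rewrite -rmorphM /= bP // !rmorphM /= mulrCA subrr.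
Qed.

Let elem_sym1_restr (H : {set 'I_n}) : (#|G| < #|H|)%N -> restr H (elem_sym k (~: G) 1) != 0.
Proof.
move=> GH; rewrite restr_elem_sym elem_sym1_neq0 //; apply: contraTneq GH => GH0.
rewrite -leqNgt; apply: subset_leq_card; apply/subsetP => i iH.
by apply: contraT => iG; have := in_set0 i; rewrite -GH0 !inE iG iH.
Qed.

Let P_elem_sym j : P (elem_sym k (~: G) j.+1).
Proof. by apply: prime_pred_elem_sym => // i; rewrite inE; exact: GP. Qed.

(** If [G] is smaller than a facet, the sum of the variables outside [G] is regular. If [G] is a
    facet, only that facet matters at [P], and an element of [Q1] outside [Q0] is nonzero on it. *)
Lemma regular_element (Q0 Q1 : S -> Prop) :
  prime_pred Q0 -> (forall f, sr_pred D f -> Q0 f) ->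
  (forall f, Q0 f -> Q1 f) -> (forall f, Q1 f -> P f) -> (exists2 f, Q1 f & ~ Q0 f) ->
  exists2 x, P x &
    forall a, sr_pred D (x * a) -> exists2 w, ~ P w & sr_pred D (w * a).
Proof.
move=> prQ0 IQ0 Q01 Q1P [f Q1f N0].
have [Gd|dG] := ltnP #|G| d.
  exists (elem_sym k (~: G) 1); first exact: P_elem_sym.
  by apply: cop1 => j Gj; apply: elem_sym1_restr; rewrite cardF.
have [j0 Fj0] := prime_face prQ0 IQ0.
have GF j : G \subset F j -> F j = G.
  by move=> Gj; apply/esym/eqP; rewrite eqEcard Gj cardF.
have Gj0 : G = F j0 by apply/esym/GF/sub_G => i /Fj0/Q01/Q1P.
exists f; first exact: Q1P.
apply: cop1 => j /GF ->; apply/eqP => f0; apply: N0.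
apply/(prime_pred_restr (F := G) f prQ0); first by rewrite Gj0.
by rewrite f0; exact: (prime_pred0 prQ0).
Qed.

Lemma regular_pair (Q0 Q1 Q2 : S -> Prop) :
  prime_pred Q0 -> (forall f, sr_pred D f -> Q0 f) -> prime_pred Q1 ->
  (forall f, Q0 f -> Q1 f) -> (forall f, Q1 f -> Q2 f) -> (forall f, Q2 f -> P f) ->
  (exists2 f, Q1 f & ~ Q0 f) -> (exists2 f, Q2 f & ~ Q1 f) ->
  exists x y, [/\ P x, P y,
    forall a, sr_pred D (x * a) -> exists2 w, ~ P w & sr_pred D (w * a) &
    forall a c, sr_pred D (y * a - x * c) ->
      exists w b, ~ P w /\ sr_pred D (w * a - x * b)].
Proof.
move=> prQ0 IQ0 prQ1 Q01 Q12 Q2P N01 N12.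
have [j0 Fj0] := prime_face prQ0 IQ0.
have [g1 [g2 [Pg1 Pg2 g1F g2F [g20 reg]]]] :=
  prime_chain_regular_pair prP prQ1 Fj0 prQ0 Q01 Q12 Q2P N01 N12.
have Gj0 : G \subset F j0 by apply: sub_G => i /Fj0/Q01/Q12/Q2P.
have N1 := prime_pred1 prP.
(* When [G] is a facet, it is the only one seen at [P], and the pair from the trichotomy serves. *)
have [dG|Gd] := leqP d #|G|.
  have GF j : G \subset F j -> F j = G.
    by move=> Gj; apply/esym/eqP; rewrite eqEcard Gj cardF.
  have E0 := GF _ Gj0; rewrite E0 in g1F g2F reg.
  have g2G : restr G g2 != 0 by rewrite g2F; apply/eqP.
  exists g2, g1; split=> //.
    by apply: cop1 => j /GF ->.
  apply: cop2 => [i j /subsetIP[/GF -> /GF ->] _|a c /sr_facetP E]; first by rewrite setIid.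
  have [|||w [b [Nw bG Ew]]] := reg (restr G a) (restr G c); try exact: restr_idem.
    have := E j0; rewrite E0 rmorphB !rmorphM /= g1F g2F => /eqP.
    by rewrite subr_eq0 => /eqP.
  exists w => // j /GF ->; exists b.
  by have := congr1 (restr G) Ew; rewrite !rmorphM /= restr_idem.
have NFG j : G \subset F j -> exists2 i, i \in F j & i \notin G.
  move=> Gj; apply/subsetPn; apply: contraTN Gd => /subset_leq_card.
  by rewrite cardF -leqNgt.
(* In codimension at least two, each facet through [G] has two vertices outside [G], which makes the
   first two elementary symmetric polynomials coprime on it. *)
have [G2|G1] := leqP #|G|.+2 d.
  exists (elem_sym k (~: G) 1), (elem_sym k (~: G) 2); split; try exact: P_elem_sym.
    by apply: cop1 => j _; apply: elem_sym1_restr; rewrite cardF.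
  apply: cop2 => [i j _ dij|a c /sr_facetP E].
    by apply: elem_sym1_restr; lia.
  exists 1 => // j Gj; have [i iF iG] := NFG j Gj.
  have [l lF lG] : exists2 l, l \in F j & l \notin i |: G.
    apply/subsetPn; apply: contraTN G2 => /subset_leq_card.
    by rewrite cardF cardsU1 iG -ltnNge.
  rewrite !inE negb_or in lG; have [li lNG] := andP lG.
  have [||||b bE] := @elem_sym12_coprime k n (~: G :&: F j) i l (restr (F j) c) (restr (F j) a).
  - by rewrite !inE iG.
  - by rewrite !inE lNG.
  - by rewrite eq_sym.
  - apply/esym; have := E j; rewrite rmorphB !rmorphM /= !restr_elem_sym => /eqP.
    by rewrite subr_eq0 => /eqP.
  exists b; rewrite mul1r rmorphM /= restr_elem_sym -[LHS]restr_idem bE rmorphM /=.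
  by rewrite restr_elem_sym -setIA setIid.
(* Now [G] is a ridge. On each facet through it the sum of the variables outside [G] is a single
   variable; the partner will be an element of [P] in the variables of [G]. *)
have Gd1 : d = #|G|.+1 by lia.
have FE j i : G \subset F j -> i \in F j -> i \notin G -> F j = i |: G.
  move=> Gj iF iG; apply/esym/eqP; rewrite eqEcard cardF cardsU1 iG Gd1 leqnn andbT.
  by rewrite subUset sub1set iF.
(* Otherwise all elements of [P] on the facet [F j0] would be multiples of one variable ['X_i];
   cancelling it from [g1] and [g2] contradicts their regularity. *)
have [x Px xG] : exists2 x, P x & restr G x <> 0.
  apply: contrapT => /forall2NP xG.
  have {}xG x : P x -> restr G x = 0 by case: (xG x) => // /contrapT.
  have [i iF iG] := NFG _ Gj0; have F0E := FE _ _ Gj0 iF iG.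
  have dv g : P g -> restr (F j0) g = g -> exists h, g = 'X_i * h.
    move=> Pg gF; apply: dvd_of_restr0; rewrite -gF restr_restr -(xG g Pg).
    rewrite F0E (_ : _ :&: _ = G) //; apply/setP => l; rewrite !inE.
    by case: eqP => [->|]; rewrite ?(negPf iG).
  have [h1 h1E] := dv _ Pg1 g1F; have [h2 h2E] := dv _ Pg2 g2F.
  have rh (g h : S) : restr (F j0) g = g -> g = 'X_i * h -> g = 'X_i * restr (F j0) h.
    by move=> gF gE; rewrite -[LHS]gF gE rmorphM /= restrX iF.
  have h1R := rh _ _ g1F h1E; have h2R := rh _ _ g2F h2E.
  have [|||w [c [Nw _ Ew]]] := reg (restr (F j0) h2) (restr (F j0) h1); try exact: restr_idem.
    by rewrite h1R h2R; ring.
  have h20 : restr (F j0) h2 != 0.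
    by apply/eqP => h20; apply: g20; rewrite h2R h20 mulr0.
  apply: Nw; suff -> : w = 'X_i * c by apply: (prime_predMr prP); exact: GP.
  by apply: (mulIf h20); rewrite Ew h2R; ring.
have [z Pz [zN0 zG]] : exists2 z : S, P z & z != 0 /\ restr G z = z.
  exists (restr G x); first exact/prime_pred_restr.
  by split; [exact/eqP|exact: restr_idem].
have rG (H : {set _}) : G \subset H -> restr H z = z by move=> GH; exact: restr_fix GH zG.
exists z, (elem_sym k (~: G) 1); split; first exact: Pz.
- exact: P_elem_sym.
- by apply: cop1 => j Gj; rewrite (rG _ Gj); exact: zN0.
apply: cop2 => [i j Gij _|a c /sr_facetP E]; first by rewrite (rG _ Gij); exact: zN0.
exists 1; first exact: N1.
move=> j Gj; have [i iF iG] := NFG j Gj.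
have XE : restr (F j) (elem_sym k (~: G) 1) = 'X_i.
  rewrite restr_elem_sym (FE _ _ Gj iF iG) (_ : _ :&: _ = [set i]); first exact: elem_sym_set1.
  by apply/setP => l; rewrite !inE; case: eqP => [->|]; rewrite ?iG //; case: (l \in G).
have Ej : 'X_i * restr (F j) a = z * restr (F j) c.
  have := E j; rewrite rmorphB !rmorphM /= XE (rG _ Gj) => /eqP.
  by rewrite subr_eq0 => /eqP.
have [|b bE] := @dvd_of_restr0 k n i (restr (F j) c).
  have /eqP := congr1 (restr [set~ i]) Ej; rewrite !restrM restrX setC11 mul0r.
  rewrite eq_sym rG; last by apply/subsetP => l; rewrite !inE; apply: contraTneq => ->.
  by rewrite mulf_eq0 (negPf zN0) orFb => /eqP; exact: id.
have aE : restr (F j) a = z * b.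
  by apply: (mulfI (mpolyX_neq0 k U_(i)%MM)); rewrite Ej bE; ring.
exists b; rewrite mul1r restrM (rG _ Gj) -(restr_idem (F j) a) aE restrM (rG _ Gj).
exact: erefl.
Qed.

End AtPrime.

(** A chain of primes below [p] contracts to S, and its one or two strict inclusions feed
    [regular_element] or [regular_pair]. *)
Theorem S2_complexP : S2_complex D.
Proof.
move=> k p d' d2 dimp; have lq := sr_local_quotient p.
have prP : prime_pred (sr_prime p) := sr_prime_pred p.
have [Q [QP Qlt]] := krull_dim_ge_chain lq dimp.
have IP (f : {mpoly k[n]}) : sr_pred D f -> sr_prime p f.
  by move=> If; case: (QP 0%N isT) => _ IQ QP0; exact: QP0 (IQ _ If).
case: d' d2 dimp QP Qlt => [|[|[|d']]] d2 dimp QP Qlt; last by [].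
- exists [::]; split=> //.
- have [prQ0 IQ0 _] := QP 0%N isT; have [_ _ Q1P] := QP 1%N isT.
  have [Q01 N01] := Qlt 0%N isT.
  have [x Px xP] := regular_element prP prQ0 IQ0 Q01 Q1P N01.
  exact: (lq_depth_ge1 lq Px xP).
have [prQ0 IQ0 _] := QP 0%N isT; have [prQ1 _ _] := QP 1%N isT.
have [_ _ Q2P] := QP 2%N isT.
have [Q01 N01] := Qlt 0%N isT; have [Q12 N12] := Qlt 1%N isT.
have [x [y [Px Py xP yP]]] := regular_pair prP prQ0 IQ0 prQ1 Q01 Q12 Q2P N01 N12.
exact: (lq_depth_ge2 lq Px Py xP yP).
Qed.

End S2Criterion.

(** * Dimension and systems of parameters *)

Lemma wide_kernel (k : fieldType) (a b : nat) (M : 'M[k]_(a, b)) :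
  (b < a)%N -> exists2 v : 'rV[k]_a, v != 0 & v *m M = 0.
Proof.
move=> ba; have : kermx M != 0.
  by rewrite kermx_eq0 /row_free ltn_eqF // (leq_ltn_trans (rank_leq_col M)).
by move=> /rowV0Pn[v /sub_kermxP vM v0]; exists v.
Qed.

(** * Polynomial relations and the dimension of polynomial rings *)

Section AlgebraicDependence.
Variables (k : fieldType) (m : nat).
Local Notation S := {mpoly k[m]}.

Definition deg_le (p : S) (e : nat) : Prop := forall u, u \in msupp p -> (mdeg u <= e)%N.

Lemma deg_leM p q e f : deg_le p e -> deg_le q f -> deg_le (p * q) (e + f).
Proof.
move=> pe qf u /msuppM_le /allpairsP[[v w] /= [vp wq ->]].
by rewrite mdegD leq_add ?pe ?qf.
Qed.

Lemma deg_leX p e i : deg_le p e -> deg_le (p ^+ i) (e * i).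
Proof.
move=> pe; elim: i => [|i IH]; last by rewrite exprS mulnS; exact: deg_leM.
by move=> u; rewrite expr0 -mpolyC1 msupp1 inE => /eqP ->; rewrite mdeg0.
Qed.

Lemma deg_leW p e f : (e <= f)%N -> deg_le p e -> deg_le p f.
Proof. by move=> ef pe u /pe/leq_trans; apply. Qed.

Variable N : nat.

Fixpoint words (r : nat) : seq (seq nat) :=
  if r is r'.+1 then [seq i :: s | i <- iota 0 N, s <- words r'] else [:: [::]].

Fixpoint word_mon (y : nat -> S) (s : seq nat) : S :=
  if s is i :: s' then y 0%N ^+ i * word_mon (y \o succn) s' else 1.

Lemma size_words r : size (words r) = (N ^ r)%N.
Proof. by elim: r => //= r IH; rewrite size_allpairs size_iota IH expnS. Qed.

Lemma uniq_words r : uniq (words r).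
Proof.
elim: r => //= r IH; apply: allpairs_uniq => //; first exact: iota_uniq.
by move=> [a b] [c d] _ _ /= [-> ->].
Qed.

Lemma word_mon_deg D r y s : (forall i, (i < r)%N -> deg_le (y i) D) ->
  s \in words r -> deg_le (word_mon y s) (r * (D * N)).
Proof.
elim: r y s => [|r IH] y s yD.
  rewrite inE => /eqP ->; rewrite mul0n => u /=; rewrite -mpolyC1 msupp1 inE => /eqP ->.
  by rewrite mdeg0.
move=> /allpairsP[[i t] /= []]; rewrite mem_iota add0n => /= iN tw ->.
rewrite mulSn; apply: deg_leM; last by apply: IH => // j jr; exact: yD.
apply: (@deg_leW _ (D * i)); first by rewrite leq_mul2l (ltnW iN) orbT.
by apply: deg_leX; exact: yD.
Qed.

(* A polynomial relation among prime chain witnesses y 0, y 1, .. is trivial: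
   divide it by the largest power of y 0 and reduce modulo the next prime. *)
Lemma chain_independent r (Q : nat -> S -> Prop) (y : nat -> S) (c : seq nat -> k) :
  (forall i, (i <= r)%N -> prime_pred (Q i)) ->
  (forall i, (i < r)%N -> (forall f, Q i f -> Q i.+1 f) /\ (Q i.+1 (y i) /\ ~ Q i (y i))) ->
  Q 0%N (\sum_(s <- words r) c s *: word_mon y s) ->
  forall s, s \in words r -> c s = 0.
Proof.
elim: r Q y c => [|r IH] Q y c prQ Qlt.
  rewrite big_seq1 => Q0 s; rewrite inE => /eqP ->; apply/eqP; apply: contrapT => /negP c0.
  apply: (prime_pred1 (prQ 0%N isT)).
  rewrite -[1](scale1r 1) -(mulVf c0) -scalerA -mul_mpolyC.
  exact: (prime_predMl (prQ 0%N isT)).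
pose A i := \sum_(s <- words r) c (i :: s) *: word_mon (y \o succn) s.
have -> : \sum_(s <- words r.+1) c s *: word_mon y s = \sum_(i < N) y 0%N ^+ i * A i.
  rewrite /= big_allpairs_dep /= -[X in iota _ X]subn0.
  rewrite -/(index_iota 0 N) big_mkord; apply: eq_bigr => i _; rewrite mulr_sumr.
  by apply: eq_bigr => s _; rewrite scalerAr.
move=> Q0.
have [Q01 [Qy Ny]] := Qlt 0%N isT.
have pr0 := prQ 0%N isT.
suff H i : (i < N)%N -> forall s, s \in words r -> c (i :: s) = 0.
  move=> s /allpairsP[[i t] /= []]; rewrite mem_iota add0n => /= iN tw ->.
  exact: H.
elim/ltn_ind: i => i IHi iN.
have A0 (j : nat) : (j < i)%N -> A j = 0.
  move=> ji; rewrite /A big_seq big1 // => s sw; rewrite (IHi j) ?scale0r //.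
  exact: ltn_trans iN.
apply: (IH (Q \o succn) (y \o succn) (fun s => c (i :: s))) => [j jr|j jr|] /=.
- exact: prQ.
- exact: (Qlt j.+1).
rewrite -/(A i).
have split_sum : \sum_(j < N) y 0%N ^+ j * A j =
    y 0%N ^+ i * (A i + y 0%N * \sum_(i.+1 <= j < N) y 0%N ^+ (j - i.+1) * A j).
  rewrite -(big_mkord xpredT (fun j => y 0%N ^+ j * A j)) (big_cat_nat (n := i)) //=; last exact: ltnW.
  rewrite big_nat big1 ?add0r => [|j /andP[_ ji]]; last by rewrite A0 // mulr0.
  rewrite big_ltn // mulrDr; congr (_ + _); rewrite !mulr_sumr big_nat [RHS]big_nat.
  apply: eq_bigr => j /andP[ij _].
  by rewrite !mulrA -exprSr -exprD subnKC.
move: Q0; rewrite split_sum => /(prime_predM pr0)[/(prime_predX pr0)//|/Q01].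
rewrite addrC => /(prime_pred_addl (prQ 1%N isT)); apply.
exact: (prime_predMr (prQ 1%N isT)).
Qed.

End AlgebraicDependence.

(** By counting, the words give more products than there are monomials available to them, so some
    nontrivial linear combination vanishes. *)
Lemma algebraic_dependence (k : fieldType) (m : nat) (y : nat -> {mpoly k[m]}) :
  exists N (c : seq nat -> k), (exists2 s, s \in words N m.+1 & c s <> 0) /\
    \sum_(s <- words N m.+1) c s *: word_mon y s = 0.
Proof.
have [D yD] : exists D, forall i, (i < m.+1)%N -> deg_le (y i) D.
  exists (\max_(i < m.+1) msize (y i))%N => i im u /msize_mdeg_lt ui.
  by apply: (leq_trans (ltnW ui)); exact: (leq_bigmax (Ordinal im)).
(* Each product has degree at most [m.+1 * (D * N)], which is below [L], so at most
   [L ^ m = B ^ m * N ^ m] monomials occur. This is less than the number [N ^ m.+1] of words because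
   [B ^ m < N]. *)
pose B := (m.+1 * D).+1; pose N := (B ^ m).+1; pose L := (B * N)%N.
pose W := words N m.+1.
pose M := \matrix_(i < size W, j < #|{ffun 'I_m -> 'I_L}|)
  (word_mon y (nth [::] W i))@_[multinom (enum_val j x : nat) | x < m].
have [|v v0 vM] := wide_kernel M.
  rewrite card_ffun !card_ord size_words expnMn expnSr mulnC ltn_pmul2l ?expn_gt0 //.
exists N, (fun s => if insub (index s W) is Some i then v 0 i else 0); split.
  have [i vi] : exists i, v 0 i != 0.
    apply: contrapT => /forallNP H; case/eqP: v0; apply/rowP => i; rewrite mxE.
    by apply/eqP; apply: contrapT => /negP/H.
  exists (nth [::] W i); first exact: mem_nth.
  by rewrite index_uniq ?uniq_words // valK; apply/eqP.
rewrite -/W (big_nth [::]) big_mkord.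
under eq_bigr => i _ do rewrite index_uniq ?uniq_words // valK.
apply/mpolyP => u; rewrite raddf_sum mcoeff0 /=.
under eq_bigr do rewrite mcoeffZ.
have [/forallP uL|/forallPn[x ux]] := boolP [forall x, (u x < L)%N].
  have := congr1 (fun A : 'rV_#|{ffun 'I_m -> 'I_L}| =>
    A 0 (enum_rank [ffun x => Ordinal (uL x)])) vM.
  rewrite /= !mxE => E; rewrite -[RHS]E; apply: eq_bigr => i _; rewrite mxE enum_rankK.
  congr (_ * mcoeff _ _); apply/mnmP => x; by rewrite mnmE ffunE.
rewrite big1 // => i _; rewrite memN_msupp_eq0 ?mulr0 //; apply/negP.
move=> /(@word_mon_deg k m N D m.+1 y _ yD) uW.
have /uW : nth [::] W i \in words N m.+1 by exact: mem_nth.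
move=> du; have : (u x <= mdeg u)%N by rewrite mdegE (bigD1 x) //= leq_addr.
move: ux; rewrite -leqNgt => Lu ud.
have : (m.+1 * (D * N) < L)%N by rewrite /L /B mulnA ltn_pmul2r.
by rewrite ltnNge (leq_trans Lu (leq_trans ud du)).
Qed.

(** Witnesses of [m.+1] strict inclusions admit only trivial relations by [chain_independent],
    against [algebraic_dependence]. *)
Lemma mpoly_chain_bound (k : fieldType) (m : nat) (Q : nat -> {mpoly k[m]} -> Prop) :
  (forall i, (i <= m.+1)%N -> prime_pred (Q i)) ->
  ~ forall i, (i < m.+1)%N -> (forall f, Q i f -> Q i.+1 f) /\
                              exists2 f, Q i.+1 f & ~ Q i f.
Proof.
move=> prQ Qlt.
have /choice[y yP] : forall i, exists f, (i < m.+1)%N -> Q i.+1 f /\ ~ Q i f.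
  move=> i; have [im|_] := ltnP i m.+1; last by exists 0.
  by have [_ [f Q1 Q2]] := Qlt i im; exists f.
have [N [c [[s sw cs]]]] := algebraic_dependence y.
move=> E; apply: cs; apply: (@chain_independent _ _ N m.+1 Q y) sw => //.
  by move=> i im; split; [case: (Qlt i im)|exact: yP].
by rewrite E; exact: (prime_pred0 (prQ 0%N isT)).
Qed.

(** * The ideal generated by a list modulo I, and its radical *)

Section CombIdeal.
Variables (A : comNzRingType) (I : A -> Prop) (xs : seq A).
Hypotheses (I0 : I 0) (ID : forall a b, I a -> I b -> I (a + b)).
Hypothesis IM : forall a b, I b -> I (a * b).

Definition comb_ideal (f : A) : Prop := exists c, I (f - comb xs c).

Lemma comb_ideal_sub f : I f -> comb_ideal f.
Proof. by move=> If; exists (fun=> 0); rewrite /comb big1 ?subr0 // => i _; rewrite mul0r. Qed.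

Lemma comb_idealD f g : comb_ideal f -> comb_ideal g -> comb_ideal (f + g).
Proof.
move=> [c If] [d Ig]; exists (fun i => c i + d i).
have -> : f + g - comb xs (fun i => c i + d i) = f - comb xs c + (g - comb xs d).
  have -> : comb xs (fun i => c i + d i) = comb xs c + comb xs d.
    by rewrite /comb -big_split; apply: eq_bigr => i _; rewrite mulrDl.
  by ring.
exact: ID.
Qed.

Lemma comb_idealM f g : comb_ideal g -> comb_ideal (f * g).
Proof.
move=> [c Ig]; exists (fun i => f * c i).
have -> : f * g - comb xs (fun i => f * c i) = f * (g - comb xs c); last exact: IM.
rewrite mulrBr /comb mulr_sumr; congr (_ - _); apply: eq_bigr => i _.
by rewrite mulrA.
Qed.

Lemma comb_ideal_mem x : x \in xs -> comb_ideal x.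
Proof.
move=> xxs; exists (fun i => (i == index x xs)%:R).
have lt : (index x xs < size xs)%N by rewrite index_mem.
rewrite /comb (bigD1 (Ordinal lt)) //= eqxx mul1r nth_index // big1 ?addr0 ?subrr // => i.
by rewrite -val_eqE /= => /negPf ->; rewrite mul0r.
Qed.

(** Each binomial term contains [g] to at least the power [l] or [f] to at least the power [e]. *)
Lemma comb_ideal_radicalD f g e l :
  comb_ideal (f ^+ e) -> comb_ideal (g ^+ l) -> comb_ideal ((f + g) ^+ (e + l)).
Proof.
move=> Jf Jg; rewrite exprDn.
apply: (big_ind comb_ideal); [exact: comb_ideal_sub|exact: comb_idealD|].
move=> [i /= _] _; rewrite -mulr_natl; apply: comb_idealM.
have [il|li] := leqP l i.
  by rewrite -(subnK il) exprD mulrA; exact: comb_idealM.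
have ei : (e <= e + l - i)%N by rewrite -addnBA ?leq_addr // ltnW.
by rewrite mulrC -(subnK ei) exprD mulrA; exact: comb_idealM.
Qed.

Lemma comb_ideal_radical_sum (J : finType) (F : J -> A) :
  (forall j, exists e, comb_ideal (F j ^+ e)) -> exists e, comb_ideal ((\sum_j F j) ^+ e).
Proof.
move=> FJ; apply: (big_ind (fun x => exists e, comb_ideal (x ^+ e))) => //.
  by exists 1%N; rewrite expr1; exact: comb_ideal_sub.
by move=> x y [e xe] [l yl]; exists (e + l)%N; exact: comb_ideal_radicalD.
Qed.

End CombIdeal.

Lemma eval0E (k : fieldType) (n : nat) (f : {mpoly k[n]}) : eval0 f = f@_0%MM.
Proof.
have [g fE] := eval0_split f; rewrite [in RHS]fE mcoeffD mcoeffC eqxx mulr1.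
rewrite raddf_sum big1 ?addr0 //= => i _; rewrite mulrC mcoeffM big1 // => -[u v] /= /eqP/esym/eqP.
rewrite mnmD_eq0 => /andP[/eqP u0 _].
by rewrite u0 mcoeffX mnm1_eq0 mul0r.
Qed.

Lemma eval0_restr (k : fieldType) (n : nat) (F : {set 'I_n}) (f : {mpoly k[n]}) :
  eval0 (restr F f) = eval0 f.
Proof.
rewrite !eval0E mcoeff_restr (_ : msup 0%MM = set0) ?sub0set //.
by apply/setP => i; rewrite !inE mnm0E.
Qed.

(** * The localization at the irrelevant ideal *)

Section Irrelevant.
Variables (n d : nat) (D : simplicial_complex n) (J : finType) (F : J -> {set 'I_n}).
Hypothesis DF : forall G, (G \in (D : {set {set 'I_n}})) <-> exists j, G \subset F j.
Hypothesis cardF : forall j, #|F j| = d.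
Variable k : fieldType.
Local Notation S := {mpoly k[n]}.
Local Notation A := (localization (@irrelevant k n D)).
Local Notation iota := (local_iota (@irrelevant k n D)).

Lemma irrelevant_sr_prime (f : S) : sr_prime (@irrelevant k n D) f <-> eval0 f = 0.
Proof.
rewrite /sr_prime -[sr_proj_morph k D f]/(sr_proj D f) irrelevantE.
by split=> /eqP.
Qed.

Let lq : local_quotient iota (@sr_pred k n D) (sr_prime (@irrelevant k n D)).
Proof. exact: sr_local_quotient. Qed.

(** The smallest prime of a chain contains all variables outside some facet, so the chain lives in a
    polynomial ring in [d] variables. *)
Lemma irrelevant_dim_lt : ~ krull_dim_ge A d.+1.
Proof.
move=> /(krull_dim_ge_chain lq)[Q [QP Qlt]].
have [prQ0 IQ0 _] := QP 0%N isT.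
have [j Fj] := prime_face DF prQ0 IQ0.
have [h [r [hK rK]]] := face_ring_retract k (F j).
have Q0 i : (i <= d.+1)%N -> forall f, Q 0%N f -> Q i f.
  elim: i => // i IH id f Q0f; have [sub _] := Qlt i id.
  by apply: sub; apply: IH => //; exact: ltnW.
have E i : (i <= d.+1)%N -> forall f, Q i (h (r f)) <-> Q i f.
  move=> id f; rewrite rK; have [prQ _ _] := QP i id.
  by apply: prime_pred_restr => // l /Fj; exact: Q0.
apply: (@mpoly_chain_bound k #|F j| (fun i => Q i \o h)) => i id;
  have {}id := leq_trans id (eq_leq (congr1 succn (cardF j))).
  by have [prQ _ _] := QP i id; exact: prime_pred_preim.
have [sub [f Q1 Q2]] := Qlt i id; split=> [g /sub //|].
by exists (r f) => /=; [apply/E|move/E => H; apply: Q2; apply: H; exact: ltnW].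
Qed.

Lemma restr_prime_pred (G : {set 'I_n}) : prime_pred (fun f : S => restr G f = 0).
Proof.
split=> [|/eqP|f g f0 g0|f g g0|f g].
- exact: rmorph0.
- by rewrite rmorph1 oner_eq0.
- by rewrite rmorphD /= f0 g0 addr0.
- by rewrite rmorphM /= g0 mulr0.
by rewrite rmorphM /= => /eqP; rewrite mulf_eq0 => /orP[]/eqP; [left|right].
Qed.

(** The chain consists of the kernels of restriction to shrinking initial segments of a facet; each
    step drops one vertex, whose variable witnesses strictness. *)
Lemma irrelevant_dim_ge (j : J) : krull_dim_ge A d.
Proof.
pose G i := [set x in take (d - i) (enum (F j))].
have sz : size (enum (F j)) = d by rewrite -cardE cardF.
have GF i : G i \subset F j.
  by apply/subsetP => x; rewrite inE => /mem_take; rewrite mem_enum.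
have take_sub l m (s : seq 'I_n) x : (l <= m)%N -> x \in take l s -> x \in take m s.
  by move=> lm; rewrite -(take_takel _ lm) => /mem_take.
apply: (chain_krull_dim_ge (Q := fun i f => restr (G i) f = 0) lq) => [i id|i id].
  split=> [|f /sr_predP f0|f f0]; first exact: restr_prime_pred.
    by apply: f0; apply/DF; exists j.
  by apply/irrelevant_sr_prime; rewrite -(eval0_restr (G i)) f0 /eval0 rmorph0.
have lt : (d - i.+1 < size (enum (F j)))%N by rewrite sz; lia.
split=> [f|].
  rewrite -(@restr_sub k n (G i.+1) (G i)) => [->|]; first exact: rmorph0.
  by apply/subsetP => x; rewrite !inE; apply: take_sub; lia.
have [x0 _] : exists x : 'I_n, x \in enum (F j).
  by case: (enum (F j)) lt => // x s _; exists x; rewrite inE eqxx.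
exists 'X_(nth x0 (enum (F j)) (d - i.+1)).
  rewrite restrX inE; case: ifP => // /(nthP x0)[l]; rewrite size_takel ?sz; last lia.
  move=> ll; rewrite nth_take // => /eqP; rewrite nth_uniq ?enum_uniq //; last by rewrite sz; lia.
  by move/eqP => E; rewrite E ltnn in ll.
rewrite restrX inE ifT; last first.
  have -> : (d - i = (d - i.+1).+1)%N by lia.
  by rewrite (take_nth x0) // mem_rcons inE eqxx.
by move/eqP; apply/negP; exact: mpolyX_neq0.
Qed.

Let sr_pred0 : sr_pred D (0 : S).
Proof. by apply/sr_predP => G _; rewrite rmorph0. Qed.

Let sr_predD (f g : S) : sr_pred D f -> sr_pred D g -> sr_pred D (f + g).
Proof. exact: rpredD. Qed.

Let sr_predMl (f g : S) : sr_pred D g -> sr_pred D (f * g).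
Proof. exact: idealMr. Qed.

(** Modulo the parameters and the face ideal, all elementary symmetric polynomials of positive
    degree of a block vanish, those of degree above [d0] being zero on every facet. So each variable
    is nilpotent by [elem_sym_ideal_power]. *)
Lemma sop_of_blocks (t d0 : nat) (C : nat -> {set 'I_n}) (j0 : J) :
  d = (t * d0)%N ->
  (forall i, exists2 c, (c < t)%N & i \in C c) ->
  (forall c j, (c < t)%N -> (#|C c :&: F j| <= d0)%N) ->
  system_of_parameters
    [seq iota f | f <- [seq elem_sym k (C c) i.+1 | c <- seq.iota 0 t, i <- seq.iota 0 d0]].
Proof.
move=> dE Ccov Ccard; set xs := [seq elem_sym _ _ _ | c <- _, i <- _].
have sxs : size xs = d by rewrite size_allpairs !size_iota.
split.
- rewrite size_map sxs; split; [exact: irrelevant_dim_ge|exact: irrelevant_dim_lt].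
- move=> x /mapP[f /allpairsP[[c i] /= [_ _ ->]] ->]; apply: (lq_maximal lq).
  by apply/irrelevant_sr_prime; rewrite eval0E mcoeff0_elem_sym.
move=> y my; have [f [s [Ns E]]] := lq_frac lq y.
have /irrelevant_sr_prime f0 := lq_maximalE lq Ns E my.
have [e [c Ic]] : exists e, comb_ideal (@sr_pred k n D) xs (f ^+ e).
  have [g fE] := eval0_split f; rewrite fE f0 mpolyC0 add0r.
  apply: comb_ideal_radical_sum => // i; have [c ct iC] := Ccov i.
  exists #|C c|; rewrite exprMn; apply: comb_idealM => //.
  apply: elem_sym_ideal_power iC => //.
  - exact: comb_ideal_sub.
  - exact: comb_idealD.
  - exact: comb_idealM.
  move=> j; have [jd|dj] := ltnP j d0.
    apply: comb_ideal_mem => //; apply/allpairsP; exists (c, j).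
    by rewrite !mem_iota.
  apply: comb_ideal_sub; apply/(sr_facetP DF) => l.
  by rewrite restr_elem_sym elem_sym_eq0 // (leq_ltn_trans (Ccard c l ct)).
have prP := lq_prime lq.
exists e; have [z sz] := lq_unit lq (prime_predNX prP (n := e) Ns).
have /(ideal_genE lq)[b bE] : exists u c, ~ sr_prime (@irrelevant k n D) u /\
    sr_pred D (u * f ^+ e - comb xs c).
  by exists 1, c; rewrite mul1r; split=> //; exact: (prime_pred1 prP).
exists (fun i => z * b i); rewrite -[y ^+ e]mul1r -sz mulrAC rmorphXn -exprMn E -rmorphXn.
by rewrite bE mulrC mulr_sumr; apply: eq_bigr => i _; exact: mulrA.
Qed.

End Irrelevant.

(** * The obstruction carried by a cyclic band *)

(* The sets T 0, .., T (N - 1) are arranged cyclically and those containing a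
   given set are consecutive. *)
Definition cyclic_band (X : finType) (N : nat) (T : nat -> {set X}) : Prop :=
  forall (H : {set X}) (e : nat -> nat -> Prop),
  (forall q, e q q) -> (forall q r, e q r -> e r q) ->
  (forall q r s, e q r -> e r s -> e q s) ->
  (forall q, (q < N)%N -> H \subset T q -> H \subset T (q.+1 %% N)%N -> e q (q.+1 %% N)%N) ->
  forall q r, (q < N)%N -> (r < N)%N -> H \subset T q -> H \subset T r -> e q r.

Lemma wedge_shift (R : comNzRingType) (f g u v : R) :
  f * (v + g) - g * (u + f) = f * v - g * u.
Proof. by ring. Qed.

Lemma vertex_step (R : comNzRingType) (u x c e f s : R) :
  u * x * (c + f * e) + s = u * x * c + s + e * (u * x * f).
Proof. by ring. Qed.

Lemma wedge_cancel (R : comNzRingType) (a0 a1 w0 w1 u x r s : R) :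
  u * (x * (a0 * w1 - a1 * w0)) - (a0 * r + a1 * s) = 0 ->
  a0 * (u * x * w1 - r) = a1 * (u * x * w0 + s).
Proof.
by move=> E; apply/eqP; rewrite -subr_eq0 -[X in _ == X]E; apply/eqP; ring.
Qed.

(* Cramer's rule: the 3 x 3 determinant with rows a, a, w vanishes. *)
Lemma wedge_identity (R : comNzRingType) (a0 a1 a2 w0 w1 w2 : R) :
  a2 * (a0 * w1 - a1 * w0) - (a0 * (a2 * w1 - a1 * w2) - a1 * (a2 * w0 - a0 * w2)) = 0.
Proof. by ring. Qed.

Section Band.
Variables (k : fieldType) (n N : nat) (T : nat -> {set 'I_n}).
Local Notation S := {mpoly k[n]}.
Hypothesis N_gt0 : (0 < N)%N.
Hypothesis bandT : cyclic_band N T.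
Hypothesis capT : \bigcap_(q < N) T q = set0.

(** Agreement of neighbours spreads to all pairs, since the sets containing [T i :&: T j] are
    connected along the band. *)
Lemma band_glue (A : nat -> S) :
  (forall q, (q < N)%N -> restr (T q :&: T (q.+1 %% N)) (A q) =
                          restr (T q :&: T (q.+1 %% N)) (A (q.+1 %% N)%N)) ->
  exists f, forall q, (q < N)%N -> restr (T q) f = restr (T q) (A q).
Proof.
move=> AE; have [i j|f fP] := @glue k n 'I_N (fun q => T q) (fun q => A q).
  apply: (@bandT (T i :&: T j)
    (fun q r => restr (T i :&: T j) (A q) = restr (T i :&: T j) (A r))
    (fun=> erefl) (fun _ _ => @esym _ _ _) (fun _ _ _ => @etrans _ _ _ _)).
  - by move=> q qN Tq Tq1; apply: (restr_eq_sub _ (AE q qN)); rewrite subsetI Tq.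
  - exact: ltn_ord.
  - exact: ltn_ord.
  - exact: subsetIl.
  exact: subsetIr.
by exists f => q qN; have := fP (Ordinal qN).
Qed.

(* theta times the cocycle that equals 1 on the seam between T (N - 1) and T 0
   and 0 elsewhere is the coboundary of q |-> seam theta q. *)
Definition seam (theta : S) (q : nat) : S :=
  filt (fun G => [&& G != set0, G \subset T 0 & [forall r : 'I_N, (q <= r)%N ==> (G \subset T r)]])
       theta.

Lemma seam_next theta q : (q.+1 < N)%N ->
  restr (T q :&: T q.+1) (seam theta q) = restr (T q :&: T q.+1) (seam theta q.+1).
Proof.
move=> qN; apply/mpolyP => u; rewrite !mcoeff_restr; case: ifP => // uT.
rewrite !mcoeff_filt; congr (if [&& _, _ & _] then _ else _).
have [uq _] := subsetIP uT.
apply/forallP/forallP => H r; apply/implyP.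
  by move=> qr; have := H r; rewrite (ltnW qr).
by rewrite leq_eqVlt => /orP[/eqP <- //|qr]; have := H r; rewrite qr.
Qed.

(** On the overlap of the last and first sets, [seam theta N.-1] keeps every nonconstant monomial
    and [seam theta 0] none, as no vertex lies in all [T q]. *)
Lemma seam_last theta : theta@_0%MM = 0 ->
  restr (T N.-1 :&: T 0) (seam theta N.-1) =
  restr (T N.-1 :&: T 0) (seam theta 0) + restr (T N.-1 :&: T 0) theta.
Proof.
move=> th0; apply/mpolyP => u; rewrite mcoeffD !mcoeff_restr; case: ifP => [uT|]; last by rewrite addr0.
have [uN u0] := subsetIP uT; rewrite !mcoeff_filt u0 /=.
have [us0|us] := eqVneq (msup u) set0.
  have -> : u = 0%MM.
    apply/mnmP => i; rewrite mnm0E; apply/eqP; apply: contraT => ui.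
    by have := in_set0 i; rewrite -us0 inE ui.
  by rewrite th0 addr0.
rewrite [in X in _ = X + _]ifF /=.
  rewrite add0r ifT //; apply/forallP => r; apply/implyP => Nr.
  by have -> : r = N.-1 :> nat by have := ltn_ord r; lia.
apply/negP => /forallP H; case/set0Pn: us => i iu.
have : i \in \bigcap_(q < N) T q by apply/bigcapP => q _; apply: (subsetP (H q)).
by rewrite capT inE.
Qed.

Definition wedge (f g : S) (q : nat) : S := f * seam g q - g * seam f q.

(** Crossing the seam changes [seam f] by [f] and [seam g] by [g], and the two changes cancel in the
    wedge. *)
Lemma wedge_glue f g : f@_0%MM = 0 -> g@_0%MM = 0 ->
  exists h, forall q, (q < N)%N -> restr (T q) h = restr (T q) (wedge f g q).
Proof.
move=> f0 g0; apply: band_glue => q qN.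
have [qN1|Nq] := ltnP q.+1 N.
  by rewrite modn_small // /wedge !restrB !restrM /= !seam_next.
have -> : q = N.-1 by lia.
rewrite prednK // modnn /wedge !restrB !restrM /= !seam_last //.
exact: wedge_shift.
Qed.

End Band.

Section Obstruction.
Variables (n d : nat) (D : simplicial_complex n) (J : finType) (F : J -> {set 'I_n}).
Hypothesis DF : forall G, (G \in (D : {set {set 'I_n}})) <-> exists j, G \subset F j.
Variables (k : fieldType) (N : nat) (T : nat -> {set 'I_n}) (B : {set 'I_n}) (y : 'I_n).
Local Notation S := {mpoly k[n]}.
Hypothesis N_gt0 : (0 < N)%N.
Hypothesis bandT : cyclic_band N T.
Hypothesis capT : \bigcap_(q < N) T q = set0.
Hypothesis TB : forall q, (q < N)%N -> T q \subset B.
Hypothesis FT : forall j, exists2 q, (q < N)%N & F j :&: B \subset T q.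
Hypothesis yB : y \notin B.
Hypothesis yT : forall q, (q < N)%N -> exists j, y |: T q \subset F j.
Hypothesis cardT : forall q, (q < N)%N -> (1 < #|T q|)%N.
Hypothesis meetT : forall q, (q < N)%N -> T q :&: T (q.+1 %% N) != set0.

Let theta i : S := elem_sym k B i.+1.

Let theta0 i : (theta i)@_0%MM = 0.
Proof. exact: mcoeff0_elem_sym. Qed.

Let thetaB i : restr B (theta i) = theta i.
Proof. by rewrite restr_elem_sym setIid. Qed.

Let wedge_class i j : exists2 h : S, restr B h = h &
  forall q, (q < N)%N -> restr (T q) h = restr (T q) (wedge N T (theta i) (theta j) q).
Proof.
have [h hP] := wedge_glue N_gt0 bandT capT (theta0 i) (theta0 j).
exists (restr B h); first exact: restr_idem.
by move=> q qN; rewrite restr_sub; [exact: hP|exact: TB].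
Qed.

(** [a], [b] and [c] are glued from the wedges with index pairs 0 and 1, 2 and 1, 2 and 0; the
    relation is [wedge_identity] on each [T q]. *)
Lemma wedge_annihilated : exists a b c : S,
  [/\ restr B a = a,
      forall q, (q < N)%N -> restr (T q) a = restr (T q) (wedge N T (theta 0) (theta 1) q)
    & sr_pred D (theta 2 * a - (theta 0 * b - theta 1 * c))].
Proof.
have [a aB aT] := wedge_class 0 1; have [b bB bT] := wedge_class 2 1.
have [c cB cT] := wedge_class 2 0; exists a, b, c; split=> //.
set h := _ - _; have hB : restr B h = h.
  by rewrite /h !(restrB, restrM) /= !thetaB aB bB cB.
apply/(sr_facetP DF) => j; have [q qN Fq] := FT j.
rewrite -hB restr_restr -(restr_sub _ Fq).
suff -> : restr (T q) h = 0 by exact: restr0.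
rewrite /h !(restrB, restrM) /= aT // bT // cT // /wedge !(restrB, restrM) /=.
exact: wedge_identity.
Qed.

(* v q is the cochain with coboundary u y c, c being the seam cocycle; its
   restriction z q to the vertex y gives the contradiction. *)
Lemma wedge_not_in_ideal (a u r s : S) : restr B a = a ->
  (forall q, (q < N)%N -> restr (T q) a = restr (T q) (wedge N T (theta 0) (theta 1) q)) ->
  eval0 u <> 0 ->
  ~ sr_pred D (u * ('X_y * a) - (theta 0 * r + theta 1 * s)).
Proof.
move=> aB aT u0 /(sr_facetP DF) Iu.
pose H q := y |: T q.
pose w i q := restr (T q) (seam N T (theta i) q).
have yTq q : (q < N)%N -> y \notin T q by move=> /TB/subsetP Tq; apply: contra yB => /Tq.
have HB q : (q < N)%N -> B :&: H q = T q.
  move=> qN; apply/setP => i; rewrite !inE; case: eqP => [->|_] /=.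
    by rewrite (negPf yB) (negPf (yTq q qN)).
  by case: (boolP (i \in T q)) => [/(subsetP (TB qN)) ->|]; rewrite ?andbF.
have thH q i : (q < N)%N -> restr (H q) (theta i) = elem_sym k (T q) i.+1.
  by move=> qN; rewrite restr_elem_sym HB.
have wH q i : (q < N)%N -> restr (H q) (w i q) = w i q.
  by move=> qN; apply: restr_fix (subsetUr _ _) (restr_idem _ _).
have aH q : (q < N)%N ->
    restr (H q) a = elem_sym k (T q) 1 * w 1%N q - elem_sym k (T q) 2 * w 0%N q.
  move=> qN; rewrite -aB restr_restr setIC HB // aT // /wedge restrB !restrM /=.
  by rewrite !restr_elem_sym !(setIidPr (TB qN)).
(* On [H q] the relation equates [theta 0] times one factor with [theta 1] times another; by
   coprimality [theta 0] divides the second factor. *)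
have /choice[v vP] : forall q, exists v, (q < N)%N ->
    restr (H q) u * 'X_y * w 0%N q + restr (H q) s = elem_sym k (T q) 1 * v.
  move=> q; have [qN|_] := ltnP q N; last by exists 0.
  have /card_gt1P[x [z [xT zT xz]]] := cardT qN.
  have [|v vE] := @elem_sym12_coprime k n (T q) x z
    (restr (H q) u * 'X_y * w 1%N q - restr (H q) r)
    (restr (H q) u * 'X_y * w 0%N q + restr (H q) s) xT zT xz; last by exists v.
  have [j Hj] := yT qN; have := congr1 (restr (H q)) (Iu j).
  rewrite restr_sub // restr0 restrB restrD !restrM /= !thH // aH //.
  rewrite restrX setU11; exact: wedge_cancel.
pose z q := restr [set y] (v q).
(* A jump of the seam cochain by [f] times [theta 0] makes [z] jump by the restriction of
   [u * 'X_y * f]. This is used with [f = 0] along the band and [f = 1] at its end. *)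
have zE q : (q < N)%N -> forall f, 
    restr (T q :&: T (q.+1 %% N)) (seam N T (theta 0) q) =
    restr (T q :&: T (q.+1 %% N)) (seam N T (theta 0) (q.+1 %% N)) +
      f * restr (T q :&: T (q.+1 %% N)) (theta 0) ->
    z q = z (q.+1 %% N)%N + restr [set y] (u * 'X_y * f).
  move=> qN f; set E := T q :&: T _; set q' := (q.+1 %% N)%N => wE.
  have q'N : (q' < N)%N by rewrite ltn_mod.
  have [Eq Eq'] : E \subset T q /\ E \subset T q'.
    by split; [exact: subsetIl|exact: subsetIr].
  have E0 : E != set0 by exact: meetT.
  clearbody E.
  have KH l (El : E \subset T l) : y |: E \subset H l by exact: setUS.
  have KE l : (l < N)%N -> E \subset T l -> T l :&: (y |: E) = E.
    move=> lN El; apply/setP => i; rewrite !inE.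
    case: eqP => [->|_] /=; last first.
      by case: (boolP (i \in E)) => [/(subsetP El) ->|]; rewrite ?andbF.
    rewrite (negPf (yTq l lN)) /=; apply/esym/negbTE; apply: contra (yTq l lN) => yE.
    by exact: (subsetP El).
  have vK l : (l < N)%N -> E \subset T l ->
      restr (y |: E) u * 'X_y * restr E (seam N T (theta 0) l) + restr (y |: E) s =
      elem_sym k E 1 * restr (y |: E) (v l).
    move=> lN El; have := congr1 (restr (y |: E)) (vP l lN).
    rewrite restrD !restrM restr_elem_sym (KE l lN El) (restr_sub u (KH l El)).
    rewrite (restr_sub s (KH l El)).
    by rewrite restrX setU11 /w restr_restr setIC (KE l lN El).
  have E1 : elem_sym k E 1 != 0 by exact: elem_sym1_neq0.
  have vv : restr (y |: E) (v q) = restr (y |: E) (v q') + restr (y |: E) u * 'X_y * f.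
    apply: (mulfI E1); rewrite mulrDr -(vK q qN Eq) -(vK q' q'N Eq') wE restr_elem_sym.
    rewrite (setIidPr (subset_trans Eq (TB qN))).
    exact: vertex_step.
  have yK : [set y] \subset y |: E by exact: subsetUl.
  rewrite /z -(restr_sub (v q) yK) vv restrD (restr_sub (v q') yK); congr (_ + _).
  by rewrite !restrM (restr_sub u yK).
have z0 q : (q < N)%N -> z 0%N = z q.
  elim: q => [|q IH] qN; first exact: erefl.
  rewrite (IH (ltnW qN)).
  have := zE q (ltnW qN) 0; rewrite (modn_small qN) mul0r addr0 mulr0 restr0 addr0.
  by apply; exact: seam_next.
have NN : (N.-1 < N)%N by rewrite prednK.
have zN : z N.-1 = z 0%N + restr [set y] (u * 'X_y * 1).
  have := zE N.-1 NN 1; rewrite prednK // modnn mul1r; apply.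
  by rewrite seam_last.
(* Once around the band the total jump must be zero, although [u] has a nonzero constant term. *)
have : restr [set y] u * 'X_y == 0.
  move/eqP: zN; rewrite -(z0 _ NN) -subr_eq0 opprD addrA subrr sub0r oppr_eq0 mulr1.
  by rewrite restrM /= restrX inE eqxx.
rewrite mulf_eq0 (negPf (mpolyX_neq0 k U_(y)%MM)) orbF => /eqP uy.
by apply: u0; rewrite -(eval0_restr [set y]) uy /eval0 rmorph0.
Qed.

End Obstruction.

(** One field suffices for a refutation. Over the rationals the third parameter multiplies [a] into
    the ideal of the first two, but the variable of [y] does not. *)
Theorem band_not_buchsbaum (n t d0 N : nat) (D : simplicial_complex n) (J : finType)
    (F : J -> {set 'I_n}) (C T : nat -> {set 'I_n}) (j0 : J) (y : 'I_n) :
  (forall G, (G \in (D : {set {set 'I_n}})) <-> exists j, G \subset F j) ->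
  (forall j, #|F j| = (t * d0)%N) ->
  (forall i, exists2 c, (c < t)%N & i \in C c) ->
  (forall c j, (c < t)%N -> (#|C c :&: F j| <= d0)%N) ->
  (0 < t)%N -> (2 < d0)%N -> (0 < N)%N ->
  cyclic_band N T -> \bigcap_(q < N) T q = set0 ->
  (forall q, (q < N)%N -> T q \subset C 0%N) ->
  (forall j, exists2 q, (q < N)%N & F j :&: C 0%N \subset T q) ->
  y \notin C 0%N ->
  (forall q, (q < N)%N -> exists j, y |: T q \subset F j) ->
  (forall q, (q < N)%N -> (1 < #|T q|)%N) ->
  (forall q, (q < N)%N -> T q :&: T (q.+1 %% N)%N != set0) ->
  ~ buchsbaum_complex D.
Proof.
move=> DF cardF Ccov Ccard t0 d03 N0 bandT capT TC FT yC yT cT mT.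
move=> /(_ rat)/(_ _ (sop_of_blocks DF cardF rat j0 erefl Ccov Ccard)).
have lq := @sr_local_quotient rat n D (@irrelevant rat n D).
have [a [b [c [aC aT rel]]]] := @wedge_annihilated _ _ _ _ DF rat _ _ _ N0 bandT capT TC FT.
(* As [d0] is at least 3 and the parameters are listed block by block, the first three all belong to
   [C 0]. *)
case: t d0 t0 d03 {cardF Ccov Ccard} => [//|t] [|[|[|d0]]] // _ _.
set xs := [seq _ | _ <- _].
pose th i := elem_sym rat (C 0%N) i.+1; pose io := local_iota (@irrelevant rat n D).
have xs2 : xs`_2 = io (th 2) by [].
have txs : take 2 xs = [seq io f | f <- [:: th 0; th 1]] by [].
have sxs : (2 < size xs)%N by [].
move=> /(_ 2%N (io a) (io 'X_y) sxs); rewrite xs2 txs.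
have combE (e : nat -> {mpoly rat[n]}) : comb [:: th 0; th 1] e = th 0 * e 0%N + th 1 * e 1%N.
  by rewrite /comb /= big_ord_recl big_ord1 /= ![e _ * _]mulrC.
have genA : ideal_gen [seq io f | f <- [:: th 0; th 1]] (io (th 2) * io a).
  rewrite -rmorphM; apply/(ideal_genE lq); exists 1, (fun i => if i is 0%N then b else - c).
  split; first exact: (prime_pred1 (lq_prime lq)).
  by rewrite mul1r combE mulrN.
have maxy : in_maximal (io 'X_y).
  apply: (lq_maximal lq); apply/irrelevant_sr_prime.
  by rewrite eval0E mcoeffX mnm1_eq0.
move=> /(_ genA maxy); rewrite -rmorphM => /(ideal_genE lq)[u [e [Nu]]].
rewrite combE => Iu; apply: (wedge_not_in_ideal DF N0 capT TC yC yT cT mT aC aT _ Iu).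
by move/irrelevant_sr_prime.
Qed.

Local Close Scope quotient_scope.
Local Close Scope ring_scope.

(** * Circulant graphs *)

(** [P] holds along one of the two arcs between [q] and [r]; the outer arc is walked from [r] up to
    [N.-1], across to 0 and on to [q]. *)
Lemma cyclic_walk (N : nat) (P : pred nat) (e : nat -> nat -> Prop) :
  (forall q, e q q) -> (forall q r, e q r -> e r q) ->
  (forall q r s, e q r -> e r s -> e q s) ->
  (forall q, q < N -> P q -> P (q.+1 %% N) -> e q (q.+1 %% N)) ->
  (forall q r, q <= r -> r < N -> P q -> P r ->
    (forall s, q <= s <= r -> P s) \/ (forall s, s < N -> (s <= q) || (r <= s) -> P s)) ->
  forall q r, q < N -> r < N -> P q -> P r -> e q r.
Proof.
move=> er es et step arc.
have walk q l : q + l < N -> (forall s, q <= s <= q + l -> P s) -> e q (q + l).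
  elim: l => [|l IH] ql Pq; first by rewrite addn0.
  apply: (et _ (q + l)); first by apply: IH => [|s ?]; [lia|apply: Pq; lia].
  have := step (q + l); rewrite modn_small; last lia.
  by rewrite addnS; apply; [lia|apply: Pq; lia|apply: Pq; lia].
have main q r : q <= r -> r < N -> P q -> P r -> e q r.
  move=> qr rN Pq Pr; case: (arc q r qr rN Pq Pr) => H.
    by rewrite -(subnKC qr); apply: walk => [|s]; rewrite subnKC // => /H.
  have e1 : e r N.-1.
    have rE : N.-1 = r + (N.-1 - r) by lia.
    by rewrite rE; apply: walk => [|s ?]; [lia|apply: H; lia].
  have e2 : e 0 q by rewrite -[q]add0n; apply: walk => [|s ?]; [lia|apply: H; lia].
  apply: es; apply: (et _ _ _ e1); apply: (et _ 0 _ _ e2).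
  have NN : N.-1.+1 = N by lia.
  by have := step N.-1; rewrite NN modnn; apply; [lia|apply: H; lia|apply: H; lia].
by move=> q r qN rN Pq Pr; have [qr|/ltnW rq] := leqP q r; [|apply: es]; apply: main.
Qed.

(** * Finite checks on the three base graphs *)

Definition circ_adj (N a b x y : nat) : bool :=
  let dist := (x - y) + (y - x) in
  (x != y) && [|| dist == a, dist == b, N - dist == a | N - dist == b].

(* In C_8(1,4), C_10(2,5) and C_10(4,5) the maximal independent sets are m times
   the intervals of d0 residues, with (m, d0) = (3, 3), (3, 4) and (1, 4). *)
Definition strip (N m d0 q : nat) : seq nat := [seq (m * (q + j)) %% N | j <- iota 0 d0].

Fixpoint bitseqs (N : nat) : seq bitseq :=
  if N is N'.+1 then [seq b :: s | b <- [:: false; true], s <- bitseqs N'] else [:: [::]].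

Lemma mem_bitseqs N s : size s = N -> s \in bitseqs N.
Proof.
elim: N s => [|N IH] [|b s] // [sN].
apply: (@allpairs_f _ _ _ cons [:: false; true]); last exact: IH.
by case: b.
Qed.

Definition strip_independent N a b m d0 : bool :=
  all (fun q => all (fun x => all (fun y => ~~ circ_adj N a b x y) (strip N m d0 q))
                    (strip N m d0 q)) (iota 0 N).

Definition strip_covers N a b m d0 : bool :=
  all (fun s : bitseq =>
    all (fun x => all (fun y => ~~ [&& nth false s x, nth false s y & circ_adj N a b x y])
                      (iota 0 N)) (iota 0 N) ==>
    has (fun q => all (fun x => nth false s x ==> (x \in strip N m d0 q)) (iota 0 N)) (iota 0 N))
  (bitseqs N).

Definition strip_uniq N m d0 : bool := all (fun q => uniq (strip N m d0 q)) (iota 0 N).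

Definition strip_ridge N m d0 : bool :=
  all (fun q => size [seq x <- strip N m d0 q | x \notin strip N m d0 (q.+1 %% N)] <= 1) (iota 0 N).

(** The band property in decidable form: along one of the two arcs between [q] and [r], every strip
    contains the common part of strips [q] and [r]. *)
Definition strip_arc N m d0 : bool :=
  all (fun q => all (fun r => (q <= r) ==>
    let sub s := all (fun x => (x \in strip N m d0 r) ==> (x \in strip N m d0 s)) (strip N m d0 q) in
    all (fun s => (q <= s <= r) ==> sub s) (iota 0 N) ||
    all (fun s => (s <= q) || (r <= s) ==> sub s) (iota 0 N)) (iota 0 N)) (iota 0 N).

Definition strip_cap N m d0 : bool :=
  all (fun x => has (fun q => x \notin strip N m d0 q) (iota 0 N)) (iota 0 N).

Definition strip_meet N m d0 : bool :=
  all (fun q => has (fun x => x \in strip N m d0 (q.+1 %% N)) (strip N m d0 q)) (iota 0 N).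

Record strip_ok N a b m d0 : Prop := StripOk {
  strip_N_gt0 : 0 < N;
  strip_d_gt2 : 2 < d0;
  strip_independentP : strip_independent N a b m d0;
  strip_coversP : strip_covers N a b m d0;
  strip_uniqP : strip_uniq N m d0;
  strip_ridgeP : strip_ridge N m d0;
  strip_arcP : strip_arc N m d0;
  strip_capP : strip_cap N m d0;
  strip_meetP : strip_meet N m d0 }.

(** All conditions concern finitely many residues and subsets of them, and computation decides
    them. *)
Lemma strip_ok_8_1_4 : strip_ok 8 1 4 3 3. Proof. by split; vm_compute. Qed.
Lemma strip_ok_10_2_5 : strip_ok 10 2 5 3 4. Proof. by split; vm_compute. Qed.
Lemma strip_ok_10_4_5 : strip_ok 10 4 5 1 4. Proof. by split; vm_compute. Qed.

Lemma distnE (x y : nat) : `|x - y|%N = (x - y) + (y - x).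
Proof.
have [xy|/ltnW yx] := leqP x y; first by rewrite distnEr // (eqP xy).
by rewrite distnEl // (eqP yx) addn0.
Qed.

(** * The circulant graph as [t] disjoint copies of a small one *)

Section Strips.
Variables (N a b m d0 t : nat).
Hypotheses (ok : strip_ok N a b m d0) (t_gt0 : 0 < t).
Local Notation n := (N * t).
Local Notation G := (circulant n [:: a * t; b * t]).
Local Notation strip := (strip N m d0).

Let N_gt0 : 0 < N. Proof. exact: strip_N_gt0 ok. Qed.

Let strip_lt q x : x \in strip q -> x < N.
Proof. by move=> /mapP[j _ ->]; rewrite ltn_mod. Qed.

Let strip_indep q x y : q < N -> x \in strip q -> y \in strip q -> ~~ circ_adj N a b x y.
Proof.
move=> qN xq yq; move: (strip_independentP ok) => /allP H.
have /H/allP/(_ _ xq)/allP : q \in iota 0 N by rewrite mem_iota.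
exact.
Qed.

Let strip_cov (P : pred nat) :
  (forall x y, x < N -> y < N -> P x -> P y -> ~~ circ_adj N a b x y) ->
  exists2 q, q < N & forall x, x < N -> P x -> x \in strip q.
Proof.
move=> indP; move: (strip_coversP ok) => /allP/(_ (mkseq P N)) H.
have /implyP/(_ _)/hasP[|q] := H (mem_bitseqs (size_mkseq _ _)).
  apply/allP => x; rewrite mem_iota => /andP[_ xN]; apply/allP => y; rewrite mem_iota => /andP[_ yN].
  rewrite !nth_mkseq //; apply/negP => /and3P[Px Py xy].
  by have := indP x y xN yN Px Py; rewrite xy.
rewrite mem_iota => /andP[_ qN] /allP Hq; exists q => // x xN Px.
by have := Hq x; rewrite mem_iota xN nth_mkseq // Px; exact.
Qed.

Let strip_size q : size (strip q) = d0.
Proof. by rewrite size_map size_iota. Qed.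

Let strip_un q : q < N -> uniq (strip q).
Proof.
by move=> qN; move: (strip_uniqP ok) => /allP H; apply: H; rewrite mem_iota.
Qed.

Let strip_rdg q x y : q < N -> x \in strip q -> x \notin strip (q.+1 %% N) ->
  y \in strip q -> y \notin strip (q.+1 %% N) -> x = y.
Proof.
move=> qN xq xq1 yq yq1; move: (strip_ridgeP ok) => /allP/(_ q) H.
have {H} := H _; rewrite mem_iota => /(_ qN).
have : x \in [seq x <- strip q | x \notin strip (q.+1 %% N)] by rewrite mem_filter xq1.
have : y \in [seq x <- strip q | x \notin strip (q.+1 %% N)] by rewrite mem_filter yq1.
by case: [seq _ <- _ | _] => [|z [|]] //; rewrite !inE => /eqP -> /eqP ->.
Qed.

Let arcsP q r : q <= r -> r < N ->
  (forall s, q <= s <= r -> forall x, x \in strip q -> x \in strip r -> x \in strip s) \/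
  (forall s, s < N -> (s <= q) || (r <= s) ->
     forall x, x \in strip q -> x \in strip r -> x \in strip s).
Proof.
move=> qr rN; move: (strip_arcP ok) => /allP/(_ q) H.
have {H} := H _; rewrite mem_iota => /(_ (leq_ltn_trans qr rN))/allP/(_ r).
rewrite mem_iota qr => /(_ rN)/= /orP[] /allP H; [left|right].
  move=> s qsr x xq xr; have /H : s \in iota 0 N by rewrite mem_iota; lia.
  by rewrite qsr /= => /allP/(_ x xq); rewrite xr.
move=> s sN sq x xq xr; have /H : s \in iota 0 N by rewrite mem_iota.
by rewrite sq /= => /allP/(_ x xq); rewrite xr.
Qed.

Let capP x : x < N -> exists2 q, q < N & x \notin strip q.
Proof.
move=> xN; move: (strip_capP ok) => /allP/(_ x) H.
have /hasP[q] : has (fun q => x \notin strip q) (iota 0 N) by apply: H; rewrite mem_iota.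
by rewrite mem_iota => /andP[_ qN] xq; exists q.
Qed.

Let meetP q : q < N -> exists2 x, x \in strip q & x \in strip (q.+1 %% N).
Proof.
move=> qN; move: (strip_meetP ok) => /allP/(_ q) H.
by apply/hasP; apply: H; rewrite mem_iota.
Qed.

(** Jumps are multiples of [t], so the residue [col] names the copy containing a vertex, and the
    quotient [pos] its place in that copy. *)
Let pos (i : 'I_n) : nat := i %/ t.
Let col (i : 'I_n) : 'I_t := Ordinal (ltn_pmod i t_gt0).

Let posN i : pos i < N. Proof. by rewrite /pos ltn_divLR. Qed.

Let vertex_proof c p : c < t -> p < N -> p * t + c < n.
Proof. by move=> ct pN; nia. Qed.

Let vertexP (c p : nat) : c < t -> p < N -> exists2 i : 'I_n, pos i = p & col i = c :> nat.
Proof.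
move=> ct pN; exists (Ordinal (vertex_proof ct pN)); rewrite /pos /=.
  by rewrite divnMDl // divn_small // addn0.
by rewrite modnMDl modn_small.
Qed.

Let pos_col_inj i j : pos i = pos j -> col i = col j -> i = j.
Proof.
move=> pij /(congr1 val) /= cij; apply: val_inj => /=.
by rewrite (divn_eq i t) (divn_eq j t) cij -/(pos i) -/(pos j) pij.
Qed.

(** Within a copy, distances are [t] times those of the small graph; between copies neither a
    distance nor its complement to [n] is a multiple of [t]. *)
Let adjE i j : G i j = (col i == col j) && circ_adj N a b (pos i) (pos j).
Proof.
rewrite /= /circulant_adj /circ_adj !inE.
have ei : i = pos i * t + col i :> nat by exact: divn_eq.
have ej : j = pos j * t + col j :> nat by exact: divn_eq.
have [cij|cij] := eqVneq (col i) (col j).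
  have dE : `|i - j|%N = ((pos i - pos j) + (pos j - pos i)) * t.
    by rewrite ei ej cij distnDr distnE mulnDl !mulnBl.
  have -> : (i != j) = (pos i != pos j).
    by apply/negP/negP => H /eqP E; apply: H; apply/eqP; [exact: pos_col_inj|rewrite E].
  by rewrite dE -mulnBl !eqn_pmul2r // -!orbA.
have Nd x : (`|i - j|%N == x * t) = false.
  apply/negP => /eqP E; case/eqP: cij; apply: val_inj => /=.
  have [ij|ji] := leqP i j.
    have -> : j = x * t + i :> nat by move: E; rewrite distnEr //; lia.
    by rewrite modnMDl.
  have -> : i = x * t + j :> nat by move: E; rewrite distnEl ?(ltnW ji) //; lia.
  by rewrite modnMDl.
have Nn x : (n - `|i - j|%N == x * t) = false.
  apply/negP => /eqP E; have /negP := negbT (Nd (N - x)); apply.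
  have : `|i - j|%N < n.
    by rewrite distnE; have := ltn_ord i; have := ltn_ord j; lia.
  by move=> H; apply/eqP; rewrite mulnBl -E subKn // ltnW.
by rewrite !Nd !Nn /= andbF.
Qed.

Let block (c q : nat) : {set 'I_n} := [set i | (col i == c :> nat) && (pos i \in strip q)].

Let card_block c q : c < t -> q < N -> #|block c q| = d0.
Proof.
move=> ct qN; rewrite cardE -(size_map pos) -(strip_size q).
apply/perm_size/uniq_perm; last 1 first.
- move=> x; apply/mapP/idP => [[i]|xq].
    by rewrite mem_enum inE => /andP[_ iq] ->.
  have [i ip ic] := vertexP ct (strip_lt xq).
  by exists i; rewrite ?ip // mem_enum inE ic eqxx ip.
- rewrite map_inj_in_uniq ?enum_uniq // => i j; rewrite !mem_enum !inE.
  move=> /andP[/eqP ci _] /andP[/eqP cj _] pij; apply: pos_col_inj => //.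
  by apply: val_inj; exact: etrans ci (esym cj).
exact: strip_un.
Qed.

(** One strip is chosen in each copy, which expresses the complex as a join. *)
Let Facet (g : {ffun 'I_t -> 'I_N}) : {set 'I_n} := [set i | pos i \in strip (g (col i))].

Let card_facet g : #|Facet g| = t * d0.
Proof.
rewrite -sum1_card (partition_big col xpredT) //=.
rewrite -[t in RHS]card_ord -sum_nat_const; apply: eq_bigr => c _.
rewrite sum1_card -(card_block (ltn_ord c) (ltn_ord (g c))).
apply: eq_card => i; rewrite [LHS]unfold_in !inE andbC -val_eqE.
have [ci|//] := eqVneq (val (col i)) (val c).
by rewrite (val_inj ci : col i = c).
Qed.

Let faceP (H : {set 'I_n}) : (H \in (Ind G : {set {set 'I_n}})) <-> exists g, H \subset Facet g.
Proof.
rewrite inE; split=> [/forall_inP indH|[g /subsetP Hg]]; last first.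
  apply/forall_inP => i iH; apply/forall_inP => j jH; rewrite adjE.
  apply/negP => /andP[/eqP cij]; apply/negP.
  have := Hg _ iH; have := Hg _ jH; rewrite !inE -cij => jq iq.
  exact: (strip_indep (ltn_ord (g (col i)))).
have /fin_all_exists[g gP] : forall c : 'I_t, exists q : 'I_N,
    forall i, i \in H -> col i = c -> pos i \in strip q.
  move=> c; pose P x := [exists i in H, (col i == c) && (pos i == x)].
  have [x y _ _ /exists_inP[i iH /andP[/eqP ci /eqP <-]] /exists_inP[j jH /andP[/eqP cj /eqP <-]]|q qN qP] :=
      @strip_cov P.
    have /forall_inP/(_ j jH) := indH i iH.
    by rewrite adjE ci cj eqxx.
  exists (Ordinal qN) => i iH ci; apply: qP => //.
  by apply/exists_inP; exists i; rewrite ?ci ?eqxx.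
by exists (finfun g); apply/subsetP => i iH; rewrite inE ffunE; exact: gP.
Qed.

Let block_arc (H : {set 'I_n}) c (e : nat -> nat -> Prop) :
  (forall q, e q q) -> (forall q r, e q r -> e r q) ->
  (forall q r s, e q r -> e r s -> e q s) ->
  (forall q, q < N -> H \subset block c q -> H \subset block c (q.+1 %% N) -> e q (q.+1 %% N)) ->
  forall q r, q < N -> r < N -> H \subset block c q -> H \subset block c r -> e q r.
Proof.
move=> er es et step.
apply: (@cyclic_walk N (fun q => H \subset block c q) e er es et step).
move=> q r qr rN /subsetP Hq /subsetP Hr.
have sub s : (forall x, x \in strip q -> x \in strip r -> x \in strip s) -> H \subset block c s.
  move=> qrs; apply/subsetP => i iH; have := Hq i iH; have := Hr i iH.
  by rewrite !inE => /andP[-> ir] /andP[_ iq]; exact: qrs.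
by case: (arcsP qr rN) => A; [left|right] => s; [move=> /A|move=> sN /(A s sN)]; exact: sub.
Qed.

(** Only the copy [c] changes, and passing to the next strip loses at most one vertex. *)
Let facet_step (g g' : {ffun 'I_t -> 'I_N}) (c : 'I_t) :
  (forall l, l != c -> g' l = g l) -> g' c = (g c).+1 %% N :> nat ->
  t * d0 <= #|Facet g :&: Facet g'|.+1.
Proof.
move=> gg' gc; rewrite -(card_facet g) -(cardsID (Facet g') (Facet g)) -addn1 leq_add2l.
apply/card_le1_eqP => i j; rewrite !inE => /andP[ig' ig] /andP[jg' jg].
have colc l : pos l \notin strip (g' (col l)) -> pos l \in strip (g (col l)) -> col l = c.
  by move=> lg' lg; apply/eqP; apply: contraNT lg' => /gg' ->.
have [ci cj] := (colc i ig' ig, colc j jg' jg).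
apply: pos_col_inj; last by rewrite ci cj.
rewrite ci in ig ig'; rewrite cj in jg jg'; rewrite gc in ig' jg'.
exact: (strip_rdg (ltn_ord (g c))).
Qed.

(** The strips of [g] are exchanged for those of [g'] one copy at a time; within a copy one walks
    along the band through strips containing the trace of [H]. *)
Let facets_connected (H : {set 'I_n}) (e : {ffun 'I_t -> 'I_N} -> {ffun 'I_t -> 'I_N} -> Prop) :
  (forall i, e i i) -> (forall i j, e i j -> e j i) ->
  (forall i j l, e i j -> e j l -> e i l) ->
  (forall i j, H \subset Facet i :&: Facet j -> t * d0 <= #|Facet i :&: Facet j|.+1 -> e i j) ->
  forall i j, H \subset Facet i -> H \subset Facet j -> e i j.
Proof.
move=> er es et step g g' /subsetP Hg /subsetP Hg'.
pose mix c : {ffun 'I_t -> 'I_N} := [ffun l : 'I_t => if l < c then g' l else g l].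
suff mixP c : c <= t -> e g (mix c).
  have -> : g' = mix t by apply/ffunP => l; rewrite ffunE ltn_ord.
  exact: mixP.
elim: c => [_|c IH ct].
  by have -> : mix 0 = g by apply/ffunP => l; rewrite ffunE.
apply: (et) (IH (ltnW ct)) _; pose c' := Ordinal ct.
(* [upd q] puts strip [q] in the copy [c]; the default value of [insubd] is never reached for
   [q < N]. *)
pose upd (q : nat) : {ffun 'I_t -> 'I_N} :=
  [ffun l : 'I_t => if l == c' then insubd (g c') q else mix c l].
have updc q : q < N -> upd q c' = q :> nat by move=> qN; rewrite ffunE eqxx val_insubd qN.
have updN q l : l != c' -> upd q l = mix c l by move=> /negPf lc; rewrite ffunE lc.
have gE : mix c = upd (g c').
  apply/ffunP => l; rewrite [RHS]ffunE; case: eqP => [->|//]; apply: val_inj.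
  by rewrite val_insubd ltn_ord ffunE ltnn.
have g'E : mix c.+1 = upd (g' c').
  apply/ffunP => l; rewrite [RHS]ffunE; case: eqP => [->|/eqP lc]; apply: val_inj.
    by rewrite val_insubd ltn_ord ffunE /= ltnSn.
  rewrite !ffunE ltnS leq_eqVlt; case: eqP => // E.
  by case/eqP: lc; exact: val_inj.
pose Hc := [set i in H | col i == c'].
rewrite gE g'E; apply: (@block_arc Hc c (fun q r => e (upd q) (upd r))) => //.
- by move=> *; exact: es.
- by move=> q r s; exact: et.
- move=> q qN /subsetP Hq /subsetP Hq1; have q1N : q.+1 %% N < N by rewrite ltn_mod.
  have sub r : r < N -> (forall i, i \in Hc -> i \in block c r) -> H \subset Facet (upd r).
    move=> rN Hr; apply/subsetP => i iH; rewrite inE.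
    have [ci|ci] := eqVneq (col i) c'.
      have /Hr : i \in Hc by rewrite inE iH ci eqxx.
      rewrite inE => /andP[_]; suff -> : upd r (col i) = r :> nat by [].
      by rewrite ci updc.
    have := Hg i iH; have := Hg' i iH; rewrite !inE updN // ffunE.
    by case: ifP.
  apply: step; first by rewrite subsetI !sub.
  by apply: (@facet_step _ _ c') => [l lc|]; [rewrite !updN|rewrite !updc].
- apply/subsetP => i; rewrite inE => /andP[iH /eqP ci].
  by have := Hg i iH; rewrite !inE ci eqxx.
apply/subsetP => i; rewrite inE => /andP[iH /eqP ci].
by have := Hg' i iH; rewrite !inE ci eqxx.
Qed.

Lemma strips_S2 : S2_graph G.
Proof. exact: (S2_complexP faceP card_facet facets_connected). Qed.

Lemma strips_not_buchsbaum : 1 < t -> ~ buchsbaum_graph G.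
Proof.
move=> t1.
(* [y] is taken in copy 1, which exists because [1 < t], at place 0. The strip [p0] through 0 will
   fill all copies other than copy 0. *)
have [y yp yc] := vertexP t1 N_gt0.
have [p0 p0N /(_ 0 N_gt0 erefl) zero_p0] : exists2 q, q < N & forall x, x < N -> x == 0 -> x \in strip q.
  apply: (@strip_cov (pred1 0)) => x z _ _ /eqP -> /eqP ->.
  by rewrite /circ_adj eqxx.
pose g0 : {ffun 'I_t -> 'I_N} := [ffun=> Ordinal N_gt0].
apply: (@band_not_buchsbaum n t d0 N (Ind G) _ Facet (fun c => [set i | col i == c :> nat])
  (block 0) g0 y faceP card_facet) => //.
- by move=> i; exists (col i); rewrite ?inE.
- move=> c g ct; rewrite -(card_block ct (ltn_ord (g (Ordinal ct)))).
  apply: subset_leq_card; apply/subsetP => i; rewrite !inE => /andP[/eqP ci ip].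
  by rewrite ci eqxx /=; have -> : Ordinal ct = col i by exact: val_inj.
- exact: strip_d_gt2 ok.
- by move=> H e er es et step; exact: block_arc.
- apply/setP => i; rewrite inE; apply/negP => /bigcapP H.
  have [q qN /negP] := capP (posN i); apply.
  by have := H (Ordinal qN) isT; rewrite inE => /andP[].
- by move=> q qN; apply/subsetP => i; rewrite !inE => /andP[].
- move=> g; exists (g (Ordinal t_gt0)) => //; apply/subsetP => i; rewrite !inE => /andP[ip /eqP ci].
  by rewrite ci eqxx /=; have -> : Ordinal t_gt0 = col i by exact: val_inj.
- by rewrite inE yc.
- move=> q qN; exists [ffun c : 'I_t => if c == 0 :> nat then Ordinal qN else Ordinal p0N].
  apply/subsetP => i; rewrite !inE ffunE => /orP[/eqP ->|/andP[-> //]].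
  by rewrite yc yp.
- by move=> q qN; rewrite card_block //; exact: ltnW (strip_d_gt2 ok).
move=> q qN; have [x xq xq1] := meetP qN.
have [i ip ic] := vertexP t_gt0 (strip_lt xq).
by apply/set0Pn; exists i; rewrite !inE ic ip xq xq1.
Qed.

End Strips.

Theorem corollary6p9 (t : nat) (ht : (1 < t)%N) :
  (S2_graph (circulant (8 * t) [:: t; 4 * t]) /\
   ~ buchsbaum_graph (circulant (8 * t) [:: t; 4 * t])) /\
  ((S2_graph (circulant (10 * t) [:: 2 * t; 5 * t]) /\
    ~ buchsbaum_graph (circulant (10 * t) [:: 2 * t; 5 * t])) /\
   (S2_graph (circulant (10 * t) [:: 4 * t; 5 * t]) /\
    ~ buchsbaum_graph (circulant (10 * t) [:: 4 * t; 5 * t]))).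
Proof.
have t_gt0 : 0 < t := ltnW ht.
have := strips_not_buchsbaum strip_ok_8_1_4 t_gt0 ht.
have := strips_S2 strip_ok_8_1_4 t_gt0; rewrite mul1n => S8 B8.
split; first by split.
split; split.
- exact: strips_S2 strip_ok_10_2_5 t_gt0.
- exact: strips_not_buchsbaum strip_ok_10_2_5 t_gt0 ht.
- exact: strips_S2 strip_ok_10_4_5 t_gt0.
exact: strips_not_buchsbaum strip_ok_10_4_5 t_gt0 ht.
Qed.
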